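(* Let $G$ be the map on $\mathbb{P}^4$ associated with the Grigorchuk group, $$G(z)=\big[z_0\alpha-z_1^2(z_0+z_4): z_1^2(z_2+z_3): z_4\alpha: z_2\alpha: z_3\alpha\big],\qquad \alpha=(z_0+z_4)^2-(z_2+z_3)^2,$$ let $M=\{z\in\mathbb{P}^4\mid z_2=z_3=z_4\}$, and let $G|_M$ be the restriction of $G$ to the submanifold $M$. Then its Julia set is $$\mathcal{J}(G|_M)=X(p(A_\pi))\cup X(E_F),$$ where $X:\mathbb{P}^2\to M$, $X([w_0:w_1:w_2])=\big[w_0-\tfrac{w_2}{2}: w_1:\tfrac{w_2}{2}:\tfrac{w_2}{2}:\tfrac{w_2}{2}\big]$, $p(A_\pi)$ is the projective spectrum of the infinite dihedral group $D_\infty$ with respect to its Koopman representation $\pi$, and $E_F$ is the extended indeterminacy set of the map $F([z_0:z_1:z_2])=[z_0(z_0^2-z_1^2-z_2^2): z_1^2z_2: z_2(z_0^2-z_2^2)]$ on $\mathbb{P}^2$.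
   Context: Projective spaces carry the Fubini–Study metric. The map $X$ is a bijection of $\mathbb{P}^2$ onto $M$, and $G$ maps $M$ (off its indeterminacy points) into $M$, so $G|_M$ is a rational self-map of $M\cong\mathbb{P}^2$. Koopman representation and projective spectrum. $D_\infty=\langle a,t\mid a^2=t^2=1\rangle$ acts on the infinite rooted binary tree, whose boundary is $\partial T=\{0,1\}^{\mathbb{N}}$ with the uniform Bernoulli probability measure $\mu$, by $a(0w)=1w$, $a(1w)=0w$, $t(0w)=0\,a(w)$, $t(1w)=1\,t(w)$. The Koopman representation $\pi$ on $L^2(\partial T,\mu)$ is $(\pi(g)f)(x)=f(g^{-1}x)$. Put $A_\pi(z)=z_0I+z_1\pi(a)+z_2\pi(t)$ and $p(A_\pi)=\{z\in\mathbb{P}^2\mid A_\pi(z)\text{ is not invertible}\}$. It is known (Grigorchuk–Yang) that $p(A_\pi)=\bigcup_{-1\le x\le 1}\{z\in\mathbb{P}^2\mid z_0^2-z_1^2-z_2^2-2z_1z_2x=0\}$. For a rational map $H$ (here $H=F$ on $\mathbb{P}^2$ or $H=G|_M$ on $M$): the indeterminacy set $I=I_1$ is the set of common zeros of its homogeneous coordinate polynomials. For $n\ge1$, $I_n$ is the set of points $p$ for which there is $1\le k\le n$ such that $p,H(p),\dots,H^{\circ(k-2)}(p)\notin I$ and $H^{\circ(k-1)}(p)\in I$. The extended indeterminacy set is $E_H=\overline{\bigcup_{n\ge1}I_n}$. A point $p\notin E_H$ is a Fatou point if for every $\epsilon>0$ there is a neighborhood $U$ of $p$ with $\operatorname{diam}H^{\circ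 n}(U\setminus E_H)<\epsilon$ for all $n$. The Fatou set is the set of Fatou points and the Julia set $\mathcal{J}(H)$ is its complement (in $\mathbb{P}^2$, respectively $M$). *)

(* Defs.v *)
From HB Require Import structures.
From mathcomp Require Import all_boot all_order all_algebra.
From mathcomp Require Import sesquilinear spectral.
From mathcomp Require Import complex.
From mathcomp Require Import all_classical all_reals all_analysis.
From mathcomp Require Import measurable_realfun ring.
Import Order.TTheory GRing.Theory Num.Theory.
Import numFieldNormedType.Exports.
Set Implicit Arguments. Unset Strict Implicit. Unset Printing Implicit Defensive.
Local Open Scope classical_set_scope.
Local Open Scope ring_scope.

Section DotCosine.
Context (C : numClosedFieldType) (m : nat).
Implicit Types u v w : 'rV[C]_m.
Local Notation "''[' u , v ]" := (dotmx u v) : ring_scope.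
Local Notation "''[' u ]" := '[u, u] : ring_scope.

Definition dot_cos u v : C := `|'[u, v]| / (sqrtC '[u] * sqrtC '[v]).

Let nrm u := (sqrtC '[u])^-1 *: u.

Let nrm1 u : u != 0 -> '[nrm u] = 1.
Proof.
move=> u0; rewrite /nrm dnormZ ger0_norm ?invr_ge0 ?sqrtC_ge0 ?dnorm_ge0//.
by rewrite exprVn sqrtCK mulVf// dnorm_eq0.
Qed.

Let norm_sqrtV u : `|(sqrtC '[u])^-1| = (sqrtC '[u])^-1.
Proof. by rewrite ger0_norm // invr_ge0 sqrtC_ge0 dnorm_ge0. Qed.

Let dot_cosE u v : dot_cos u v = `|'[nrm u, nrm v]|.
Proof.
rewrite /dot_cos /nrm linearZl_LR linearZr_LR /= !normrM norm_conjC !norm_sqrtV.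
by rewrite invfM mulrC mulrA.
Qed.

Let CS u v : `|'[u, v]| ^+ 2 <= '[u] * '[v].
Proof. by have [] := CauchySchwarz (@dotmx C m) u v. Qed.

Lemma dot_cos_ge0 u v : 0 <= dot_cos u v.
Proof. by rewrite dot_cosE. Qed.

Lemma dot_cos_le1 u v : u != 0 -> v != 0 -> dot_cos u v <= 1.
Proof.
move=> u0 v0; rewrite dot_cosE -(@expr_le1 _ 2)//.
by rewrite (le_trans (CS _ _))// !nrm1// mulr1.
Qed.

Lemma dot_cosC u v : dot_cos u v = dot_cos v u.
Proof.
rewrite /dot_cos [X in _ / X]mulrC; congr (_ / _).
by rewrite (hermC (@dotmx C m)) /= expr0 mul1r norm_conjC.
Qed.

Lemma dot_cosZl c u v : c != 0 -> dot_cos (c *: u) v = dot_cos u v.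
Proof.
move=> c0; rewrite /dot_cos linearZl_LR /= dnormZ normrM.
rewrite sqrtCM ?nnegrE ?exprn_ge0 ?dnorm_ge0//.
by rewrite sqrCK// -mulrA -mulf_div divff ?normr_eq0// mul1r.
Qed.

Lemma dot_cosZr c u v : c != 0 -> dot_cos u (c *: v) = dot_cos u v.
Proof. by move=> c0; rewrite dot_cosC dot_cosZl// dot_cosC. Qed.

Lemma dot_cosxx u : u != 0 -> dot_cos u u = 1.
Proof. by move=> u0; rewrite dot_cosE nrm1// normr1. Qed.

Lemma dot_cos_eq1 u v : u != 0 -> v != 0 -> dot_cos u v = 1 ->
  <[u]>%VS = <[v]>%VS.
Proof.
move=> u0 v0; rewrite dot_cosE => e1.
have : `|'[nrm u, nrm v]| ^+ 2 == '[nrm u] * '[nrm v] = ~~ free [:: nrm u; nrm v].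
  by have [_] := CauchySchwarz (@dotmx C m) (nrm u) (nrm v).
rewrite e1 !nrm1// expr1n mulr1 eqxx free_cons span_seq1 seq1_free.
have nz w : w != 0 -> (sqrtC '[w])^-1 != 0.
  by move=> w0; rewrite invr_eq0 sqrtC_eq0 dnorm_eq0.
have -> : nrm v != 0 by rewrite scaler_eq0 negb_or nz.
rewrite andbT negbK => /esym uv.
apply/eqP; rewrite eqEdim !dim_vline u0 v0 andbT -memvE.
case/vlineP: uv => k uvE.
have -> : u = sqrtC '[u] *: nrm u.
  by rewrite scalerA mulfV ?scale1r// -invr_eq0 nz.
by rewrite uvE !memvZ// memv_line.
Qed.

Lemma dot_cos_triangle u v w : u != 0 -> v != 0 -> w != 0 ->
  dot_cos u v * dot_cos v w - dot_cos u w <=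
  sqrtC ((1 - dot_cos u v ^+ 2) * (1 - dot_cos v w ^+ 2)).
Proof.
move=> /nrm1 u1 /nrm1 v1 /nrm1 w1; rewrite !dot_cosE.
move: (nrm u) (nrm v) (nrm w) u1 v1 w1 => {}u {}v {}w u1 v1 w1.
pose a := '[u, v]; pose b := '[w, v].
have bE : `|'[v, w]| = `|b|.
  by rewrite (hermC (@dotmx C m)) /= expr0 mul1r norm_conjC.
have [u' uE ou] : exists2 u', u = u' + a *: v & '[u', v] = 0.
  by exists (u - a *: v); rewrite ?subrK// linearBl linearZl_LR /= v1 mulr1 subrr.
have [w' wE ow] : exists2 w', w = w' + b *: v & '[w', v] = 0.
  by exists (w - b *: v); rewrite ?subrK// linearBl linearZl_LR /= v1 mulr1 subrr.
have ov : '[v, w'] = 0.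
  by rewrite (hermC (@dotmx C m)) /= ow conjC0 mulr0.
have uw : '[u, w] = '[u', w'] + a * b^*.
  rewrite [in LHS]uE [in LHS]wE linearDl !linearDr /= !linearZl_LR !linearZr_LR /=.
  by rewrite ou ov v1 !mulr0 mulr1 addr0 add0r.
have nu : '[u'] = 1 - `|a| ^+ 2.
  have o : '[u', a *: v] = 0 by rewrite linearZr_LR /= ou mulr0.
  by rewrite -u1 [in RHS]uE (hnormDd o) /= dnormZ /= v1 mulr1 addrK.
have nw : '[w'] = 1 - `|b| ^+ 2.
  have o : '[w', b *: v] = 0 by rewrite linearZr_LR /= ow mulr0.
  by rewrite -w1 [in RHS]wE (hnormDd o) /= dnormZ /= v1 mulr1 addrK.
rewrite -/a bE -nu -nw.
have -> : `|a| * `|b| = `|'[u, w] - '[u', w']|.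
  by rewrite uw addrAC subrr add0r normrM norm_conjC.
apply: (@le_trans _ _ `|'[u', w']|).
  by rewrite lerBlDr (le_trans (ler_normB _ _))// addrC.
by rewrite -(sqrCK (normr_ge0 _)) ler_sqrtC ?nnegrE ?exprn_ge0 ?mulr_ge0 ?dnorm_ge0.
Qed.

End DotCosine.

Section ProjectiveSpace.
Context (R : realType) (n : nat).
Local Notation V := 'rV[R[i]]_n.+1.

(* Complex projective n-space, as the set of lines through 0 in C^(n+1). *)
Record proj := Proj { line :> {vspace V}; dim_line : \dim line == 1%N }.
HB.instance Definition _ := [isSub for line].
HB.instance Definition _ := [Choice of proj by <:].

(* Homogeneous coordinates of p. *)
Definition coords (p : proj) : V := vpick p.

Lemma proj_default_subproof : \dim <[const_mx 1 : V]>%VS == 1%N.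
Proof.
rewrite dim_vline; case: (eqVneq (const_mx 1 : V) 0) => // /matrixP/(_ 0 0)/eqP.
by rewrite !mxE oner_eq0.
Qed.

(* The point with homogeneous coordinates v; a junk value if v = 0. *)
Definition mkproj (v : V) : proj :=
  insubd (Proj proj_default_subproof) <[v]>%VS.

Lemma coords_neq0 p : coords p != 0.
Proof.
rewrite vpick0; apply: contraTneq (dim_line p) => ->.
by rewrite dimv0.
Qed.

Lemma line_coords p : line p = <[coords p]>%VS.
Proof.
apply/esym/eqP; rewrite eqEdim -memvE memv_pick /=.
by rewrite (eqP (dim_line p)) dim_vline coords_neq0.
Qed.

Lemma line_mkproj v : v != 0 -> line (mkproj v) = <[v]>%VS.
Proof. by move=> v0; rewrite val_insubd dim_vline v0. Qed.

Lemma coords_mkproj v : v != 0 -> exists2 c, c != 0 & coords (mkproj v) = c *: v.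
Proof.
move=> v0; have : coords (mkproj v) \in <[v]>%VS.
  by rewrite -line_mkproj// memv_pick.
move=> /vlineP[c cE]; exists c => //.
by apply: contra_neq (coords_neq0 (mkproj v)) => c0; rewrite cE c0 scale0r.
Qed.

Lemma coordsK : cancel coords mkproj.
Proof. by move=> p; apply: val_inj; rewrite /= line_mkproj ?coords_neq0 // -line_coords. Qed.

Lemma mkprojZ c v : c != 0 -> mkproj (c *: v) = mkproj v.
Proof.
move=> c0; congr insubd; apply/eqP; rewrite eqEdim -memvE memvZ ?memv_line //=.
by rewrite !dim_vline scaler_eq0 (negbTE c0).
Qed.

(* cos d([u], [v]) = |<u, v>| / (|u| |v|), with d in [0, pi/2]. *)
Definition fubini_study (p q : proj) : R :=
  acos (complex.Re (dot_cos (coords p) (coords q))).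

Lemma fubini_studyE u v : u != 0 -> v != 0 ->
  fubini_study (mkproj u) (mkproj v) = acos (complex.Re (dot_cos u v)).
Proof.
move=> u0 v0; rewrite /fubini_study.
have [c c0 ->] := coords_mkproj u0; have [d d0 ->] := coords_mkproj v0.
by rewrite (dot_cosZl _ _ c0) (dot_cosZr _ _ d0).
Qed.

Let dot_cos_real (u v : V) : dot_cos u v = (complex.Re (dot_cos u v))%:C%C.
Proof.
have := dot_cos_ge0 u v; case: (dot_cos u v) => a b.
by rewrite lecE /= => /andP[/eqP -> _].
Qed.

Let dot_cos_itv (p q : proj) : 0 <= complex.Re (dot_cos (coords p) (coords q)) <= 1.
Proof.
have := dot_cos_ge0 (coords p) (coords q).
have := dot_cos_le1 (coords_neq0 p) (coords_neq0 q).
by rewrite dot_cos_real !lecR => -> ->.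
Qed.

Let dot_cos_itvN p q : -1 <= complex.Re (dot_cos (coords p) (coords q)) <= 1.
Proof.
have /andP[h0 ->] := dot_cos_itv p q.
by rewrite (le_trans _ h0)// lerN10.
Qed.

Lemma cos_fubini_study p q :
  cos (fubini_study p q) = complex.Re (dot_cos (coords p) (coords q)).
Proof. by rewrite acosK// in_itv/= dot_cos_itvN. Qed.

Lemma fubini_studyxx p : fubini_study p p = 0.
Proof. by rewrite /fubini_study dot_cosxx ?coords_neq0//= acos1. Qed.

Lemma fubini_study_eq0 p q : fubini_study p q = 0 -> p = q.
Proof.
move=> d0; have := cos_fubini_study p q; rewrite d0 cos0 => e.
apply: val_inj; rewrite /= !line_coords; apply: dot_cos_eq1; rewrite ?coords_neq0//.
by rewrite dot_cos_real -e.
Qed.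

Lemma fubini_studyC p q : fubini_study p q = fubini_study q p.
Proof. by rewrite /fubini_study dot_cosC. Qed.

Let acos_triangle (x y z : R) : -1 <= x <= 1 -> -1 <= y <= 1 -> -1 <= z <= 1 ->
  x * y - z <= Num.sqrt (1 - x ^+ 2) * Num.sqrt (1 - y ^+ 2) ->
  acos z <= acos x + acos y.
Proof.
move=> xI yI zI; rewrite lerBlDl -lerBlDr => le_z.
rewrite leNgt; apply/negP => lt_acos.
have acos_pi : acos x + acos y <= pi.
  by rewrite (le_trans (ltW lt_acos))// acos_lepi.
have : cos (acos z) < cos (acos x + acos y).
  by rewrite ltr_cos// in_itv/= ?acos_ge0 ?acos_lepi// addr_ge0 ?acos_ge0.
rewrite cosD !acosK ?in_itv//= !sin_acos//.
by rewrite ltNge le_z.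
Qed.

Let sqrtC_real (x y : R) : 0 <= x -> 0 <= y ->
  sqrtC (x * y)%:C%C = (Num.sqrt x * Num.sqrt y)%:C%C.
Proof.
move=> x0 y0; rewrite -[RHS]sqrCK ?lecR ?mulr_ge0 ?sqrtr_ge0//.
by rewrite -rmorphXn/= exprMn !sqr_sqrtr.
Qed.

Lemma fubini_study_triangle q p r :
  fubini_study p r <= fubini_study p q + fubini_study q r.
Proof.
apply: acos_triangle; rewrite ?dot_cos_itvN//.
have := dot_cos_triangle (coords_neq0 p) (coords_neq0 q) (coords_neq0 r).
have := dot_cos_itv p q; have := dot_cos_itv q r.
have := dot_cos_real (coords p) (coords q); have := dot_cos_real (coords q) (coords r).
have := dot_cos_real (coords p) (coords r).
move: (dot_cos (coords p) (coords r)) (dot_cos (coords p) (coords q)) (dot_cos (coords q) (coords r)).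
move=> Z X Y -> -> ->; rewrite /complex.Re.
move: (complex.Re Z) (complex.Re X) (complex.Re Y) => z x y /andP[y0 y1] /andP[x0 x1].
rewrite -!rmorphXn -(rmorph1 (real_complex R)) -!rmorphB -!rmorphM -rmorphB.
by rewrite sqrtC_real ?lecR// subr_ge0 expr_le1.
Qed.

HB.instance Definition _ := @isMetric.Build R proj fubini_study
  fubini_studyxx fubini_study_eq0 fubini_studyC fubini_study_triangle.

End ProjectiveSpace.


Section Boundary.

(* Cylinder of the infinite binary sequences with prefix w. *)
Definition cylinder (w : seq bool) : set (nat -> bool) :=
  [set x | forall i, (i < size w)%N -> x i = nth false w i].

(* The boundary of the binary tree, with its Borel sigma-algebra. *)
Definition boundary := g_sigma_algebraType (range cylinder).

Definition scons (b : bool) (x : nat -> bool) : nat -> bool :=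
  fun k => if k is k'.+1 then x k' else b.

Definition gen_a (x : boundary) : boundary :=
  fun k => if k is 0 then ~~ x 0%N else x k.

Fixpoint gen_t_rec (x : nat -> bool) (k : nat) : bool :=
  if k is k'.+1 then
    let tl := fun i => x i.+1 in
    if x 0%N then gen_t_rec tl k' else gen_a tl k'
  else x 0%N.
Definition gen_t (x : boundary) : boundary := gen_t_rec x.

Lemma gen_a0 w : gen_a (scons false w) = scons true w.
Proof. by apply/funext => -[]. Qed.
Lemma gen_a1 w : gen_a (scons true w) = scons false w.
Proof. by apply/funext => -[]. Qed.
Lemma gen_t0 w : gen_t (scons false w) = scons false (gen_a w).
Proof. by apply/funext => -[]. Qed.
Lemma gen_t1 w : gen_t (scons true w) = scons true (gen_t w).
Proof. by apply/funext => -[]. Qed.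

Lemma gen_aK : involutive gen_a.
Proof. by move=> x; apply/funext => -[|k] //=; rewrite negbK. Qed.

Lemma gen_tK : involutive gen_t.
Proof.
move=> x; apply/funext => k; rewrite /gen_t.
elim: k x => [|k IH] x //=; case: ifP => x0; rewrite x0.
  exact: IH.
exact: (congr1 (fun f : boundary => f k) (gen_aK (fun i => x i.+1))).
Qed.

HB.instance Definition _ := @Can2.Build boundary boundary setT setT gen_a gen_a
  (fun _ h => h) (fun _ h => h) (in1W gen_aK) (in1W gen_aK).
HB.instance Definition _ := @Can2.Build boundary boundary setT setT gen_t gen_t
  (fun _ h => h) (fun _ h => h) (in1W gen_tK) (in1W gen_tK).
End Boundary.

Section Bernoulli.
Context (R : realType).

(* The binary digits of u in [0, 1[. *)
Definition digits (u : measurableTypeR R) : boundary :=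
  fun k => odd (Num.truncn (2 ^+ k.+1 * u)).

Let measurable_truncn : measurable_fun [set: R] (@Num.truncn R : R -> nat).
Proof.
move=> _ A _; rewrite setTI.
have mge k : measurable [set u : R | (k <= Num.truncn u)%N].
  case: k => [|k]; first by rewrite [X in measurable X](_ : _ = setT)//; apply/seteqP.
  rewrite [X in measurable X](_ : _ = `[k.+1%:R, +oo[%classic)//.
  by apply/seteqP; split => u /=; rewrite in_itv/= andbT truncn_gt_nat.
rewrite [X in measurable X](_ : _ = \bigcup_(k in A)
    ([set u : R | (k <= Num.truncn u)%N] `\` [set u : R | (k.+1 <= Num.truncn u)%N])).
  by apply: bigcup_measurable => k _; exact: measurableD.
apply/seteqP; split => [u /= Au|u [k Ak] /= [ku uk]].
  by exists (Num.truncn u) => //=; rewrite ltnn.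
suff -> : Num.truncn u = k by [].
by apply/eqP; rewrite eqn_leq ku andbT leqNgt; apply/negP.
Qed.

Let measurable_digit k : measurable_fun [set: R] (fun u : R => digits u k).
Proof.
apply: (measurableT_comp (f := odd)) => //.
apply: (measurableT_comp measurable_truncn).
exact: mulrl_measurable.
Qed.

Let measurable_digits_R : measurable_fun [set: R] (digits : R -> boundary).
Proof.
apply: (@measurability _ _ R boundary setT digits (range cylinder)) => // _ [_ [w _ <-] <-].
rewrite setTI [X in measurable X](_ : _ = \bigcap_(k in `I_(size w))
    ((fun u => digits u k) @^-1` [set nth false w k])).
  apply: bigcap_measurableType => k _.
  by rewrite -[X in measurable X]setTI; exact: measurable_digit.
by apply/seteqP; split.
Qed.

Lemma measurable_digits : measurable_fun [set: measurableTypeR R] digits.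
Proof. exact: measurable_digits_R. Qed.

HB.instance Definition _ :=
  isMeasurableFun.Build _ _ (measurableTypeR R) boundary digits measurable_digits.

(* The uniform Bernoulli measure, as the law of the binary digits of a uniform
   random variable on [0, 1]; see bernoulliE. *)
Definition bernoulli : set boundary -> \bar R :=
  distribution (uniform_prob (@ltr01 R)) digits.
HB.instance Definition _ := Probability.on bernoulli.

Let value (w : seq bool) := foldl (fun (k : nat) (b : bool) => k.*2 + b)%N 0%N w.

Let value_lt (w : seq bool) : (value w < 2 ^ size w)%N.
Proof.
elim/last_ind: w => [//|w b IH]; rewrite size_rcons /value foldl_rcons -/(value w).
by rewrite expnS mul2n (leq_trans _ (_ : (value w).+1.*2 <= _)%N) ?leq_double//
  doubleS !ltnS -addn1 leq_add2l; case: b.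
Qed.

Let truncn_half (x : R) : 0 <= x -> Num.truncn x = (Num.truncn (2 * x))./2.
Proof.
move=> x0; have x20 : 0 <= 2 * x by rewrite mulr_ge0.
have /andP[lo hi] := truncn_itv x0.
apply/esym/eqP; rewrite eqn_leq leq_half_double geq_half_double -ltnS -doubleS.
rewrite truncn_lt_nat// truncn_ge_nat// -!mul2n !natrM.
by rewrite ltr_pM2l// ler_pM2l// hi lo.
Qed.

Let digitsP (w : seq bool) (u : R) : 0 <= u < 1 ->
  cylinder w (digits u) <-> Num.truncn (2 ^+ size w * u) = value w.
Proof.
move=> /andP[u0 u1]; elim/last_ind: w => [|w b IH].
  rewrite /= expr0 mul1r; split => // _.
  by apply: truncn_def; rewrite u0.
have cyl_rcons : cylinder (rcons w b) (digits u) <->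
    cylinder w (digits u) /\ digits u (size w) = b.
  split=> [h|[h hb] i]; first split.
  - move=> i iw; rewrite h ?size_rcons ?(ltn_trans iw)//.
    by rewrite nth_rcons iw.
  - by rewrite h ?size_rcons// nth_rcons ltnn eqxx.
  - rewrite size_rcons ltnS leq_eqVlt nth_rcons => /orP[/eqP ->|iw].
      by rewrite ltnn eqxx.
    by rewrite iw h.
rewrite cyl_rcons {}IH size_rcons /value foldl_rcons -/(value w) /digits.
rewrite truncn_half ?mulr_ge0 ?exprn_ge0// mulrA -exprS.
set m := Num.truncn _; split=> [[<- <-]|->].
  by rewrite addnC odd_double_half.
by rewrite addnC half_bit_double oddD odd_double oddb addbF.
Qed.

Lemma bernoulliE (w : seq bool) : bernoulli (cylinder w) = (2 ^- size w)%:E.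
Proof.
set n := size w; pose A := digits @^-1` cylinder w.
have mA : measurable A.
  rewrite -[X in measurable X]setTI; apply: measurable_digits => //.
  by apply: sub_sigma_algebra; exists w.
have n0 : 0 < 2 ^+ n :> R by rewrite exprn_gt0.
pose I := `[(value w)%:R / 2 ^+ n, (value w).+1%:R / 2 ^+ n[%classic : set R.
have I1 u : I u -> 0 <= u < 1.
  rewrite /I /= in_itv/= ler_pdivrMr// ltr_pdivlMr// => /andP[lo hi].
  rewrite -(pmulr_lge0 u n0) (le_trans _ lo)//= -(ltr_pM2r n0) mul1r.
  by rewrite (lt_le_trans hi)// -natrX ler_nat value_lt.
have IA u : 0 <= u < 1 -> A u <-> I u.
  move=> u01; have /andP[u0 _] := u01.
  rewrite /A /= digitsP// /I /= in_itv/= ler_pdivrMr// ltr_pdivlMr//.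
  rewrite -truncn_eq ?mulr_ge0 ?(ltW n0)// [u * _]mulrC.
  by split => [->|/eqP].
have lebI : lebesgue_measure I = (2 ^- n)%:E.
  rewrite /I lebesgue_measure_itv/= lte_fin ltr_pM2r ?invr_gt0// ltr_nat leqnn.
  by rewrite -EFinD -mulrBl -natrB// subSnn mul1r.
transitivity (lebesgue_measure (A `&` `[0%R, 1%R])).
  have -> : bernoulli (cylinder w) =
      (\int[lebesgue_measure]_(u in A) (uniform_pdf 0 1 u)%:E)%E by [].
  rewrite integral_uniform_pdf (eq_integral (cst 1%E)); last first.
    move=> u; rewrite inE => -[_]; rewrite /= in_itv/= /uniform_pdf => ->.
    by rewrite subr0 invr1.
  by rewrite integral_cst ?mul1e//; exact: measurableI.
have mA1 : measurable (A `&` `[0%R, 1%R]) by exact: measurableI.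
have mI : measurable I by exact: measurable_itv.
have mI1 : measurable (I `|` [set 1%R]) by exact: measurableU.
apply/eqP; rewrite eq_le -lebI; apply/andP; split; last first.
  apply: le_measure; rewrite ?inE; [exact: mI|exact: mA1|move=> u Iu].
  have u01 := I1 _ Iu; have /andP[u0 u1] := u01.
  by split; [exact/(IA _ u01)|rewrite /= in_itv/= u0 ltW].
apply: (@le_trans _ _ (lebesgue_measure (I `|` [set 1%R]))).
  apply: le_measure; rewrite ?inE; [exact: mA1|exact: mI1|].
  move=> u [Au]; rewrite /= in_itv/= => /andP[u0].
  rewrite le_eqVlt => /orP[/eqP ->|u1]; first by right.
  by left; apply/IA; rewrite ?u0.
apply: (@le_trans _ _ (lebesgue_measure I + lebesgue_measure [set 1%R])%E).
  by apply: measureU2; [exact: mI|exact: measurable_set1].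
by rewrite lebesgue_measure_set1 adde0.
Qed.

End Bernoulli.

Section Koopman.
Context (R : realType).
Local Notation mu := (bernoulli R).
Local Notation fn := (boundary -> R[i]).

(* Elements of the complex space L^2(mu) are handled through representatives:
   functions f satisfying L2 f, considered up to equality mu-almost everywhere. *)
Definition L2 (f : fn) : Prop :=
  (@complex.Re R \o f) \in Lfun mu 2%:E /\ (@complex.Im R \o f) \in Lfun mu 2%:E.

Definition L2norm (f : fn) : \bar R :=
  Lnorm mu 2%:E (fun x => (complex.Re `|f x|)%:E).

(* Together, the last two clauses make B compatible with equality mu-a.e. *)
Definition bounded_L2_operator (B : fn -> fn) : Prop :=
  [/\ forall f, L2 f -> L2 (B f),
      forall (c : R[i]) f g, L2 f -> L2 g ->
        {ae mu, forall x, B (fun y => c * f y + g y) x = c * B f x + B g x}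
    & exists K : R, forall f, L2 f -> (L2norm (B f) <= K%:E * L2norm f)%E].

Definition L2_invertible (A : fn -> fn) : Prop :=
  exists2 B, bounded_L2_operator B &
    forall f, L2 f -> {ae mu, forall x, A (B f) x = f x} /\
                      {ae mu, forall x, B (A f) x = f x}.

(* The Koopman operator pi(g) of a bijection g of the boundary. *)
Definition koopman (g : {splitbij [set: boundary] >-> [set: boundary]})
  (f : fn) : fn := f \o g^-1%FUN.

Definition A_pi (z : 'rV[R[i]]_3) (f : fn) : fn :=
  fun x => z 0 0 * f x + z 0 1 * koopman gen_a f x + z 0 2 * koopman gen_t f x.

Definition projective_spectrum : set (proj R 2) :=
  [set p | ~ L2_invertible (A_pi (coords p))].

End Koopman.

Definition diam (R : realType) (T : metricType R) (A : set T) : R :=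
  sup [set mdist pq.1 pq.2 | pq in A `*` A].

(* H is the rational self-map of M, a subset of P^n, whose homogeneous
   coordinate polynomials are the entries of Q. *)
Section Dynamics.
Context (R : realType) (n : nat).
Context (Q : 'rV[R[i]]_n.+1 -> 'rV[R[i]]_n.+1) (M : set (proj R n)).

(* Junk where the entries of Q have a common zero. *)
Definition rational_map (p : proj R n) : proj R n := mkproj (Q (coords p)).
Local Notation H := rational_map.

Definition indeterminacy : set (proj R n) :=
  [set p | M p /\ Q (coords p) = 0].
Local Notation I := indeterminacy.

Definition indeterminacy_upto (m : nat) : set (proj R n) :=
  [set p | M p /\ exists k, [/\ (1 <= k <= m)%N,
     forall j, (j < k.-1)%N -> ~ I (iter j H p) & I (iter k.-1 H p)]].

Definition extended_indeterminacy : set (proj R n) :=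
  M `&` closure (\bigcup_(m in [set m | (1 <= m)%N]) indeterminacy_upto m).
Local Notation E := extended_indeterminacy.

Definition fatou : set (proj R n) :=
  [set p | [/\ M p, ~ E p & forall eps : R, 0 < eps ->
     exists2 U, nbhs p U &
       forall k, diam (iter k H @` ((M `&` U) `\` E)) < eps]].

Definition julia : set (proj R n) := M `\` fatou.

Lemma rational_map_mkproj d v :
  (forall (c : R[i]) u, Q (c *: u) = c ^+ d *: Q u) ->
  v != 0 -> rational_map (mkproj v) = mkproj (Q v).
Proof.
move=> Qh v0; rewrite /rational_map.
by have [c c0 ->] := coords_mkproj v0; rewrite Qh mkprojZ// expf_neq0.
Qed.

End Dynamics.

Section Maps.
Context (R : realType).
Local Notation C := R[i].

Definition row_of_seq n (s : seq C) : 'rV[C]_n := \row_j s`_j.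

(* The indices 0, ..., n-1 of 'I_n are written with the numerals of Z/nZ. *)
Definition F_map (z : 'rV[C]_3) : 'rV[C]_3 :=
  let z0 := z 0 0 in let z1 := z 0 1 in let z2 := z 0 2 in
  row_of_seq 3 [:: z0 * (z0 ^+ 2 - z1 ^+ 2 - z2 ^+ 2);
                   z1 ^+ 2 * z2;
                   z2 * (z0 ^+ 2 - z2 ^+ 2)].

Definition G_map (z : 'rV[C]_5) : 'rV[C]_5 :=
  let z0 := z 0 0 in let z1 := z 0 1 in let z2 := z 0 2 in
  let z3 := z 0 3 in let z4 := z 0 4 in
  let alpha := (z0 + z4) ^+ 2 - (z2 + z3) ^+ 2 in
  row_of_seq 5 [:: z0 * alpha - z1 ^+ 2 * (z0 + z4);
                   z1 ^+ 2 * (z2 + z3);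
                   z4 * alpha;
                   z2 * alpha;
                   z3 * alpha].

Definition M_set : set (proj R 4) :=
  [set p | let z := coords p in z 0 2 = z 0 3 /\ z 0 3 = z 0 4].

Definition X_map (p : proj R 2) : proj R 4 :=
  let w := coords p in let h := w 0 2 / 2 in
  mkproj (row_of_seq 5 [:: w 0 0 - h; w 0 1; h; h; h]).

Lemma F_map_homog (c : C) z : F_map (c *: z) = c ^+ 3 *: F_map z.
Proof.
apply/rowP => -[[|[|[|//]]] hj]; rewrite !mxE /=; ring.
Qed.

Lemma G_map_homog (c : C) z : G_map (c *: z) = c ^+ 3 *: G_map z.
Proof.
apply/rowP => -[[|[|[|[|[|//]]]]] hj]; rewrite !mxE /=; ring.
Qed.

Lemma G_map_stable p : M_set p -> ~ indeterminacy G_map M_set p ->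
  M_set (rational_map G_map p).
Proof.
move=> Mp nI; have Gp0 : G_map (coords p) != 0 by apply/eqP => G0; apply: nI.
rewrite /rational_map /M_set /=; have [c _ ->] := coords_mkproj Gp0.
by case: Mp => p23 p34; rewrite !mxE /= p34 p23 p34.
Qed.

End Maps.

(* Main.v *)
From HB Require Import structures.
From mathcomp Require Import all_boot all_order all_algebra.
From mathcomp Require Import sesquilinear spectral.
From mathcomp Require Import complex.
From mathcomp Require Import all_classical all_reals all_analysis.
From mathcomp Require Import measurable_realfun ring lra.
Require Import Defs.
Import Order.TTheory GRing.Theory Num.Theory.
Import numFieldNormedType.Exports.
Set Implicit Arguments. Unset Strict Implicit. Unset Printing Implicit Defensive.
Local Open Scope classical_set_scope.
Local Open Scope ring_scope.

(** The linear map behind [X] intertwines the polynomial maps [F] and [G] and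
    distorts norms by bounded factors, so it transports indeterminacy, closures
    and equicontinuity: the statement reduces to [J(F) = p(A_pi) U E_F] on the
    plane ([transport_julia], [julia_F]).

    Both sides are governed by the ratio
    [x = (z0^2 - z1^2 - z2^2) / (2 z1 z2)], which [F] maps to [2 x^2 - 1]. Write
    [x = (l + 1 / l) / 2]. Then [F] squares [l], and the n-th iterate has the
    closed form [z0 U : z1 : z2 U + z1 U'] with Chebyshev values [U], [U'] of
    indices [2^n - 1] and [2^n - 2] at [x] ([F_Phi], [iter_F]). Every point
    either has [x] in [-1, 1], or admits [|l| < 1] ([level_dichotomy]).

    Dynamics. If [|l| < 1], the iterates tend to [z0 : 0 : z2 + l z1], uniformly
    near the point, unless this limit degenerates; that happens only at
    [0 : 1 : -l], which is a limit of preimages of the contracted line z0 = z2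
    and hence lies in [E_F] ([axis_extended_indeterminacy], [fatou_level]). If
    [x] is in [-1, 1], there are points nearby for which [l] is a root of unity
    of order a power of 2, and whose orbits end at [0 : 1 : -1], as well as points
    with [|l| < 1], whose orbits approach the line z1 = 0; the two limits are far
    apart ([not_fatou_ratio]).

    Spectrum. Let [u = a t], which acts on the boundary as an odometer. The
    product of [A = z0 + z1 a + z2 t] with [z0 - z1 a - z2 t] is
    [z0^2 - z1^2 - z2^2 - z1 z2 (u + u^-1)]. If [|l| < 1] this is a multiple of
    [(1 - l u) (1 - l u^-1)], which is inverted by pointwise Neumann series
    ([neumann_invertible], [A_pi_invertible]). If [x] is in [-1, 1], it is a limit
    of real parts of roots of unity of order a power of 2; these are eigenvalues
    of [u] ([odometer_eigenfunction]), and they make nearby operators have a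
    kernel ([dyadic_kernel]), so that [A] is not bounded below
    ([A_pi_not_invertible]). *)

(** * The Fubini-Study distance in homogeneous coordinates *)
Section LineDistance.
Context (C : numClosedFieldType) (m : nat).
Implicit Types u v : 'rV[C]_m.
Local Notation "''[' u , v ]" := (dotmx u v) : ring_scope.
Local Notation "''[' u ]" := '[u, u] : ring_scope.

Lemma dotmx_sum u : '[u] = \sum_j `|u 0 j| ^+ 2.
Proof.
rewrite dotmxE mxE; apply: eq_bigr => j _.
by rewrite !mxE normCK.
Qed.

(** The orthogonal decomposition of [u - c v] along [v]. Minimizing over [c], the
    distance from [u] to the line of [v] is [|u|] times the sine of their
    Fubini-Study distance. *)
Lemma sqnorm_dist_line u v c : v != 0 ->
  '[u - c *: v] = '[u] * (1 - dot_cos u v ^+ 2) +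
                  `|c - '[u, v] / '[v]| ^+ 2 * '[v].
Proof.
move=> v0; have [->|u0] := eqVneq u 0.
  rewrite sub0r hnormN /= dnormZ /= !linear0l /=.
  by rewrite subr0 add0r.
pose c0 := '[u, v] / '[v].
have v2 : '[v] != 0 by rewrite dnorm_eq0.
have u2 : '[u] != 0 by rewrite dnorm_eq0.
have o : '[u - c0 *: v, v] = 0.
  by rewrite linearBl linearZl_LR /= /c0 divfK// subrr.
have -> : u - c *: v = (u - c0 *: v) + (c0 - c) *: v.
  by rewrite scalerBl addrA subrK.
have oc : '[u - c0 *: v, (c0 - c) *: v] = 0 by rewrite linearZr_LR /= o mulr0.
rewrite (hnormDd oc) /= dnormZ /= [`|c0 - c|]distrC; congr (_ + _).
have -> : '[u - c0 *: v] = '[u] - `|'[u, v]| ^+ 2 / '[v].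
  rewrite [LHS]linearBr /= linearZr_LR /= o mulr0 subr0.
  rewrite linearBl linearZl_LR /= /c0; congr (_ - _).
  rewrite [ '[v, u] ](hermC (@dotmx C m)) /= expr0 mul1r normCK.
  by rewrite mulrAC.
rewrite /dot_cos expr_div_n exprMn !sqrtCK mulrBr mulr1; congr (_ - _).
by field; rewrite u2 v2.
Qed.

Lemma sqnorm_dist_line_ge u v c : v != 0 ->
  '[u] * (1 - dot_cos u v ^+ 2) <= '[u - c *: v].
Proof.
by move=> v0; rewrite (sqnorm_dist_line _ _ v0) lerDl mulr_ge0 ?exprn_ge0// dnorm_ge0.
Qed.

Lemma sqnorm_dist_line_eq u v : v != 0 ->
  exists c, '[u - c *: v] = '[u] * (1 - dot_cos u v ^+ 2).
Proof.
move=> v0; exists ('[u, v] / '[v]).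
by rewrite (sqnorm_dist_line _ _ v0) subrr normr0 expr0n mul0r addr0.
Qed.
End LineDistance.

Section ProjectiveMetric.
Context (R : realType) (n : nat).
Local Notation C := R[i].
Implicit Types (u v : 'rV[C]_n.+1) (p q : proj R n).
Local Notation "''[' u ]" := (dotmx u u) : ring_scope.

Lemma gt0_realE (s : C) : 0 < s -> s = (complex.Re s)%:C%C.
Proof. by case: s => a b; rewrite ltcE /= => /andP[/eqP -> _]. Qed.

Lemma mkproj_surj p : exists2 v, v != 0 & p = mkproj v.
Proof. by exists (coords p); rewrite ?coords_neq0 ?coordsK. Qed.

Lemma dot_cos_realE u v : dot_cos u v = (complex.Re (dot_cos u v))%:C%C.
Proof.
have := dot_cos_ge0 u v; case: (dot_cos u v) => a b.
by rewrite lecE /= => /andP[/eqP -> _].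
Qed.

Lemma Re_dot_cos_itv u v : u != 0 -> v != 0 ->
  0 <= complex.Re (dot_cos u v) <= 1.
Proof.
move=> u0 v0; have := dot_cos_ge0 u v; have := dot_cos_le1 u0 v0.
by rewrite dot_cos_realE !lecR => -> ->.
Qed.

Lemma mdist_mkproj u v : u != 0 -> v != 0 ->
  mdist (mkproj u) (mkproj v) = acos (complex.Re (dot_cos u v)).
Proof. exact: fubini_studyE. Qed.

Lemma mdist_proj_lepi p q : mdist p q <= pi.
Proof.
have [u u0 ->] := mkproj_surj p; have [v v0 ->] := mkproj_surj q.
rewrite mdist_mkproj// acos_lepi//; have /andP[h0 ->] := Re_dot_cos_itv u0 v0.
by rewrite (le_trans _ h0)// lerN10.
Qed.

Lemma ltr_acos (x e : R) : -1 <= x <= 1 -> 0 <= e <= pi ->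
  (acos x < e) = (cos e < x).
Proof.
move=> x1 e1; rewrite -{2}(@acosK _ x) ?in_itv//= ltr_cos// in_itv//=.
by rewrite acos_ge0 ?acos_lepi.
Qed.

(** Together with [close_representative], this reduces statements about the
    Fubini-Study metric to Euclidean estimates on homogeneous coordinates. *)
Lemma mkproj_close (eps : R) : 0 < eps ->
  exists2 s : C, 0 < s & forall u v, u != 0 -> '[u - v] <= s * '[u] ->
    v != 0 /\ mdist (mkproj u) (mkproj v) < eps.
Proof.
move=> e0; pose e := Num.min eps (pi / 2).
have pi0 := @pi_gt0 R.
have e_gt0 : 0 < e by rewrite lt_min e0 divr_gt0.
have e_le : e <= pi / 2 by rewrite ge_min lexx orbT.
have e_pi : 0 <= e <= pi by apply/andP; split; lra.
pose c := cos e.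
have c0 : 0 <= c by rewrite cos_ge0_pihalf// e_le (le_trans _ (ltW e_gt0))// oppr_le0 divr_ge0 ?pi_ge0.
have c1 : c < 1.
  rewrite /c -cos0 ltr_cos ?in_itv//= ?lexx ?pi_ge0//.
(* a squared sine at most [s] forces the cosine to exceed [c] *)
pose s := (1 - c ^+ 2) / 2.
have c21 : c ^+ 2 < 1 by rewrite expr_lt1.
have s0 : 0 < s by rewrite /s; lra.
have s1 : s < 1 by have := sqr_ge0 c; rewrite /s; lra.
exists s%:C%C => [|u v u0 uv]; first by rewrite ltcR.
have u2 : 0 < '[u] by rewrite dnorm_gt0.
have v0 : v != 0.
  apply: contraTneq uv => ->; rewrite subr0 lt_geF//.
  by rewrite gtr_pMl// -[1](rmorph1 (real_complex R)) ltcR.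
split => //; rewrite mdist_mkproj//.
have := sqnorm_dist_line_ge u 1 v0; rewrite scale1r => /le_trans/(_ uv).
rewrite [s%:C%C * _]mulrC ler_pM2l//.
have /andP[] := Re_dot_cos_itv u0 v0; rewrite dot_cos_realE /=.
set r := complex.Re _ => r0 r1.
rewrite -[1](rmorph1 (real_complex R)) -rmorphXn -rmorphB lecR => rs.
apply: (@lt_le_trans _ _ e); last by rewrite ge_min lexx.
rewrite ltr_acos// ?r1 ?andbT; last by lra.
rewrite -/c -(ltr_pXn2r (n := 2)) ?nnegrE//.
have : 1 - r ^+ 2 <= (1 - c ^+ 2) / 2 by [].
by lra.
Qed.

(** The representative is the orthogonal projection of [u] to the line [q]; it is
    nonzero because the sine of the distance is bounded away from 1. *)
Lemma close_representative (s : C) : 0 < s ->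
  exists2 eps : R, 0 < eps & forall u q, u != 0 -> mdist (mkproj u) q < eps ->
    exists v, [/\ v != 0, q = mkproj v & '[u - v] <= s * '[u]].
Proof.
move=> s0; have sE := gt0_realE s0.
have {}s0 : 0 < complex.Re s by move: s0; rewrite sE ltcR.
pose t := Num.min (complex.Re s) (1 / 2).
have t0 : 0 < t by rewrite lt_min s0/= divr_gt0.
have ts : t <= complex.Re s by rewrite ge_min lexx.
have t1 : t <= 1 / 2 by rewrite ge_min lexx orbT.
have I1 : -1 <= 1 - t / 2 <= 1 by apply/andP; split; lra.
exists (acos (1 - t / 2)).
  by rewrite acos_gt0//; apply/andP; split; lra.
move=> u q u0; have [w w0 ->] := mkproj_surj q.
have u2 : 0 < '[u] by rewrite dnorm_gt0.
rewrite mdist_mkproj// ltr_acos; last 2 first.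
- by have /andP[h ->] := Re_dot_cos_itv u0 w0; rewrite (le_trans _ h)// lerN10.
- by rewrite acos_ge0// acos_lepi.
rewrite acosK ?in_itv//= => tr.
have [c cE] := sqnorm_dist_line_eq u w0.
have le_t : '[u - c *: w] <= t%:C%C * '[u].
  rewrite cE [t%:C%C * _]mulrC ler_pM2l// dot_cos_realE.
  rewrite -[1](rmorph1 (real_complex R)) -rmorphXn -rmorphB lecR.
  set r := complex.Re _ in tr *.
  have : (1 - t / 2) ^+ 2 <= r ^+ 2 by rewrite ler_pXn2r ?nnegrE//; lra.
  have := sqr_ge0 t.
  by rewrite /real_complex_def/=; nra.
have c0 : c != 0.
  apply: contraTneq le_t => ->; rewrite scale0r subr0 lt_geF// gtr_pMl//.
  by rewrite -[1](rmorph1 (real_complex R)) ltcR; lra.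
exists (c *: w); split; first by rewrite scaler_eq0 negb_or c0.
- by rewrite mkprojZ.
- by rewrite (le_trans le_t)// sE ler_pM2r// lecR.
Qed.

End ProjectiveMetric.

(** * Fatou and Julia sets in metric terms *)
Lemma least_witness (P : nat -> Prop) : (exists k, P k) ->
  exists2 k, P k & forall j, (j < k)%N -> ~ P j.
Proof.
move=> exP; have exk : exists k, `[< P k >] by case: exP => k ?; exists k; exact/asboolP.
have [k /asboolP Pk kmin] := ex_minnP exk; exists k => // j jk Pj.
by have := kmin j (asboolT Pj); rewrite leqNgt jk.
Qed.

Section Dynamics_metric.
Context (R : realType) (n : nat).
Local Notation C := R[i].
Context (Q : 'rV[C]_n.+1 -> 'rV[C]_n.+1) (M : set (proj R n)).
Local Notation H := (rational_map Q).
Local Notation I := (indeterminacy Q M).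
Local Notation E := (extended_indeterminacy Q M).
Implicit Types p q : proj R n.

Lemma closureP (S : set (proj R n)) p :
  closure S p <-> forall eps : R, 0 < eps -> exists2 q, S q & mdist p q < eps.
Proof.
split=> [Sp eps e0|Sp B /nbhs_ballP[eps /= e0 epsB]].
  have [q [Sq]] := Sp _ (nbhsx_ballx p eps e0).
  by rewrite ballEmdist /=; exists q.
by have [q Sq pq] := Sp _ e0; exists q; split => //; apply: epsB; rewrite ballEmdist.
Qed.

Lemma closure_metric_not (S : set (proj R n)) p : ~ closure S p ->
  exists2 eps : R, 0 < eps & forall q, mdist p q < eps -> ~ closure S q.
Proof.
move=> nSp; have : nbhs p (~` closure S).
  by apply: open_nbhs_nbhs; split => //; exact/closed_openC/closed_closure.
by move=> /nbhs_ballP[eps /= e0 epsS]; exists eps.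
Qed.

Lemma mem_diam (A : set (proj R n)) p q : A p -> A q -> mdist p q <= diam A.
Proof.
move=> Ap Aq; apply: ub_le_sup; last by exists (p, q).
by exists pi => _ [pq _ <-]; exact: mdist_proj_lepi.
Qed.

Lemma diam_le (A : set (proj R n)) (e : R) : 0 <= e ->
  (forall p q, A p -> A q -> mdist p q <= e) -> diam A <= e.
Proof.
move=> e0 Ae; rewrite /diam; set B := (X in sup X).
have [->|B0] := eqVneq B set0; first by rewrite sup0.
by apply: ge_sup => [|_ [pq [Ap Aq] <-]]; [exact/set0P|exact: Ae].
Qed.

(** Passing through the least such [k] shows that only the existence of an
    iterate in the indeterminacy set matters. *)
Lemma bigcup_indeterminacy_upto p :
  (\bigcup_(m in [set m | (1 <= m)%N]) indeterminacy_upto Q M m) p <->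
  M p /\ exists k, I (iter k H p).
Proof.
split=> [[m _ [Mp [k [_ _ Ik]]]]|[Mp Ik]]; first by split => //; exists k.-1.
have [k kI kmin] := least_witness Ik.
by exists k.+1 => //; split => //; exists k.+1; split; [rewrite /= leqnn| |].
Qed.

Lemma not_extended_indeterminacy p : M p -> ~ E p -> forall k, ~ I (iter k H p).
Proof.
move=> Mp nE k Ik; apply: nE; split => //; apply: subset_closure.
by apply/bigcup_indeterminacy_upto; split => //; exists k.
Qed.

(** The diameter condition compares two moving points; it suffices to compare
    each of them with [p], which is itself outside [E]. *)
Lemma fatouP p : fatou Q M p <->
  [/\ M p, ~ E p & forall eps : R, 0 < eps -> exists2 d : R, 0 < d &
    forall k q, M q -> ~ E q -> mdist p q < d ->
      mdist (iter k H p) (iter k H q) < eps].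
Proof.
split=> -[Mp nEp Fp]; split => // eps e0.
  have [U /nbhs_ballP[d /= d0 dU] Ueps] := Fp _ e0.
  exists d => // k q Mq nEq pq; apply: le_lt_trans (Ueps k).
  apply: mem_diam; [exists p|exists q] => //; do 2 split => //; apply: dU.
  - exact: ballxx.
  - by rewrite ballEmdist.
have e30 : 0 < eps / 3 by lra.
have [d d0 dF] := Fp _ e30.
exists (ball p d) => [|k]; first exact: nbhsx_ballx.
apply: (@le_lt_trans _ _ (eps / 3 + eps / 3)); last by lra.
apply: diam_le => [|_ _ [q [[Mq +] nEq] <-] [r [[Mr +] nEr] <-]]; first by lra.
rewrite ballEmdist /= => pq pr.
apply: (le_trans (metric_triangle _ (iter k H p) _)).
by apply: lerD; apply: ltW; [rewrite metric_sym|]; apply: dF.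
Qed.

End Dynamics_metric.

(** * Transport along a linear embedding *)
Section Transport.
Context (R : realType) (n m d : nat).
Local Notation C := R[i].
Context (Q : 'rV[C]_n.+1 -> 'rV[C]_n.+1) (Q' : 'rV[C]_m.+1 -> 'rV[C]_m.+1).
Context (L : 'rV[C]_n.+1 -> 'rV[C]_m.+1) (K : C) (M : set (proj R m)).
Local Notation "''[' u ]" := (dotmx u u) : ring_scope.
Hypothesis LB : forall u v, L (u - v) = L u - L v.
Hypothesis LZ : forall c u, L (c *: u) = c *: L u.
Hypothesis K0 : 0 < K.
Hypothesis L_le : forall u, '[L u] <= K * '[u].
Hypothesis L_ge : forall u, '[u] <= K * '[L u].
Hypothesis QL : forall u, Q' (L u) = L (Q u).
Hypothesis Q'Z : forall c u, Q' (c *: u) = c ^+ d *: Q' u.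
Let X (p : proj R n) : proj R m := mkproj (L (coords p)).
Hypothesis M_X : M = range X.
Local Notation H := (rational_map Q).
Local Notation H' := (rational_map Q').

Let L0 u : L u = 0 -> u = 0.
Proof.
move=> Lu; apply/eqP; rewrite -(dnorm_eq0 (@dotmx C n.+1)) /=.
have := L_ge u; rewrite Lu linear0l /= mulr0 => u0.
by rewrite eq_le u0 dnorm_ge0.
Qed.

Let Lneq0 u : u != 0 -> L u != 0.
Proof. by apply: contra_neq; exact: L0. Qed.

Let X_mkproj v : v != 0 -> X (mkproj v) = mkproj (L v).
Proof.
by move=> v0; rewrite /X; have [c c0 ->] := coords_mkproj v0; rewrite LZ mkprojZ.
Qed.

(** Linear maps that distort norms by a bounded factor distort small
    Fubini-Study distances in a controlled way; [K * K] appears since both the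
    difference and the reference vector are distorted. *)
Lemma transport_continuous (eps : R) : 0 < eps -> exists2 e : R, 0 < e &
  forall p q, mdist p q < e -> mdist (X p) (X q) < eps.
Proof.
move=> /(mkproj_close m)[s s0 sE].
have s'0 : 0 < s / (K * K) by rewrite divr_gt0// mulr_gt0.
have [e e0 eE] := close_representative n s'0.
exists e => // p q; have [u u0 ->] := mkproj_surj p.
move=> /(eE _ _ u0)[v [v0 -> uv]]; rewrite !X_mkproj//.
apply: (sE _ _ (Lneq0 u0) _).2; rewrite -LB (le_trans (L_le _))//.
rewrite (le_trans (ler_wpM2l (ltW K0) uv))//.
rewrite (le_trans (_ : _ <= K * (s / (K * K) * (K * '[L u]))))//.
  by rewrite ler_pM2l// ler_pM2l.
by rewrite le_eqVlt; apply/orP; left; apply/eqP; field; rewrite gt_eqF.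
Qed.

Lemma transport_inv_continuous (eps : R) : 0 < eps -> exists2 e : R, 0 < e &
  forall p q, mdist (X p) (X q) < e -> mdist p q < eps.
Proof.
move=> /(mkproj_close n)[s s0 sE].
have s'0 : 0 < s / (K * K) by rewrite divr_gt0// mulr_gt0.
have [e e0 eE] := close_representative m s'0.
exists e => // p q; have [u u0 ->] := mkproj_surj p; have [v v0 ->] := mkproj_surj q.
rewrite !X_mkproj// => /(eE _ _ (Lneq0 u0))[w [w0 vw uw]].
have [c c0 wE] : exists2 c, c != 0 & w = c *: L v.
  have [a a0 aE] := coords_mkproj (Lneq0 v0).
  have [b b0 bE] := coords_mkproj w0.
  exists (b^-1 * a); first by rewrite mulf_neq0 ?invr_eq0.
  by rewrite -scalerA -aE vw bE scalerA mulVf// scale1r.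
rewrite -(mkprojZ v c0); apply: (sE _ _ u0 _).2.
rewrite (le_trans (L_ge _))// LB LZ -wE.
rewrite (le_trans (ler_wpM2l (ltW K0) uw))//.
rewrite (le_trans (_ : _ <= K * (s / (K * K) * (K * '[u]))))//.
  by rewrite ler_pM2l// ler_pM2l.
by rewrite le_eqVlt; apply/orP; left; apply/eqP; field; rewrite gt_eqF.
Qed.

Let Q'0 p : Q' (coords (X p)) = 0 <-> Q (coords p) = 0.
Proof.
have [c c0 cE] := coords_mkproj (Lneq0 (coords_neq0 p)); rewrite cE Q'Z QL.
split=> [/eqP|->].
  by rewrite scaler_eq0 expf_eq0 (negbTE c0) andbF /= => /eqP /L0.
have -> : L 0 = 0 by rewrite -(scale0r (0 : 'rV_n.+1)) LZ scale0r.
by rewrite scaler0.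
Qed.

Let MX p : M (X p). Proof. by rewrite M_X; exists p. Qed.

Let indetX p : indeterminacy Q' M (X p) <-> indeterminacy Q setT p.
Proof. by split=> [[_ /Q'0]|[_ /Q'0]]; split. Qed.

Let mapX p : ~ indeterminacy Q setT p -> H' (X p) = X (H p).
Proof.
move=> nI; have Q0 : Q (coords p) != 0 by apply/eqP => Q0; apply: nI.
rewrite (rational_map_mkproj Q'Z) ?Lneq0 ?coords_neq0//.
by rewrite QL /rational_map X_mkproj.
Qed.

Let iterX k p : (forall j, (j < k)%N -> ~ indeterminacy Q setT (iter j H p)) ->
  iter k H' (X p) = X (iter k H p).
Proof.
elim: k => [//|k IH] nI /=.
rewrite IH; first by rewrite mapX//; exact: nI.
by move=> j jk; apply: nI; rewrite (ltn_trans jk).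
Qed.

(* Away from the indeterminacy set the two maps are conjugate, but their junk
   values on it differ: hence the passage through first hitting times. *)
Let hitX p : (exists k, indeterminacy Q' M (iter k H' (X p))) <->
  (exists k, indeterminacy Q setT (iter k H p)).
Proof.
split=> -[k Ik].
  apply: contrapT => nk; have nI j : ~ indeterminacy Q setT (iter j H p).
    by move=> Ij; apply: nk; exists j.
  by move: Ik; rewrite iterX// => /indetX /nI.
have [l Il lmin] := least_witness (ex_intro (fun k => indeterminacy Q setT (iter k H p)) k Ik).
by exists l; rewrite iterX//; exact/indetX.
Qed.

Lemma transport_extended_indeterminacy p :
  extended_indeterminacy Q' M (X p) <-> extended_indeterminacy Q setT p.
Proof.
split=> -[_ /closureP Ep]; split => //; apply/closureP => eps e0.
  have [e e_gt0 eX] := transport_inv_continuous e0.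
  have [r /bigcup_indeterminacy_upto[+ hq] pq] := Ep _ e_gt0.
  rewrite M_X => -[q _ qE]; move: hq pq; rewrite -qE => /hitX hq /eX pq.
  by exists q => //; apply/bigcup_indeterminacy_upto.
have [e e_gt0 eX] := transport_continuous e0.
have [q /bigcup_indeterminacy_upto[_ hq] /eX pq] := Ep _ e_gt0.
by exists (X q) => //; apply/bigcup_indeterminacy_upto; split => //; exact/hitX.
Qed.

Lemma transport_fatou p : fatou Q' M (X p) <-> fatou Q setT p.
Proof.
have iterE q : ~ extended_indeterminacy Q setT q -> forall k, iter k H' (X q) = X (iter k H q).
  by move=> nE k; apply: iterX => j _; exact: not_extended_indeterminacy.
split=> /fatouP[_ nE Fp]; apply/fatouP; split => //.
- by move=> /transport_extended_indeterminacy.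
- have nEp : ~ extended_indeterminacy Q setT p.
    by move=> /transport_extended_indeterminacy.
  move=> eps /transport_inv_continuous[e1 e10 e1X].
  have [e2 e20 e2F] := Fp _ e10; have [e e0 eX] := transport_continuous e20.
  exists e => // k q _ nEq /eX pq; apply: e1X; rewrite -!iterE//; apply: e2F => //.
  by move=> /transport_extended_indeterminacy.
- by move=> /transport_extended_indeterminacy.
move=> eps /transport_continuous[e1 e10 e1X].
have [e2 e20 e2F] := Fp _ e10; have [e e0 eX] := transport_inv_continuous e20.
exists e => // k r; rewrite {1}M_X => -[q _ <-] nEXq /eX pq.
have nEq : ~ extended_indeterminacy Q setT q.
  by move=> /transport_extended_indeterminacy.
by rewrite !iterE//; apply: e1X; exact: e2F.
Qed.

Theorem transport_julia : julia Q' M = X @` julia Q setT.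
Proof.
apply/seteqP; split=> [r [+ nF]|_ [p [_ nF] <-]].
  rewrite {1}M_X => -[p _ pE]; exists p => //; split => //.
  by move=> /transport_fatou; rewrite pE.
by split => // /transport_fatou.
Qed.

End Transport.

(** * Iterates of F along the level sets of the invariant ratio *)
Section Iterates.
Context (R : realType).
Local Notation C := R[i].
Local Notation "''[' u ]" := (dotmx u u) : ring_scope.
Implicit Types (v w : 'rV[C]_3) (k l P : C).
Local Notation H := (rational_map (@F_map R)).
Local Notation I := (indeterminacy (@F_map R) setT).
Local Notation E := (extended_indeterminacy (@F_map R) setT).

Definition vec3 (a b c : C) : 'rV[C]_3 := row_of_seq 3 [:: a; b; c].

Lemma vec3E0 a b c : vec3 a b c 0 0 = a. Proof. by rewrite mxE. Qed.
Lemma vec3E1 a b c : vec3 a b c 0 1 = b. Proof. by rewrite mxE. Qed.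
Lemma vec3E2 a b c : vec3 a b c 0 2 = c. Proof. by rewrite mxE. Qed.
Definition vec3E := (vec3E0, vec3E1, vec3E2).

Lemma vec3_eta v : v = vec3 (v 0 0) (v 0 1) (v 0 2).
Proof.
apply/rowP => -[[|[|[|//]]] hj]; rewrite !mxE /=; congr (v _ _);
by apply/val_inj.
Qed.

Lemma vec3_eq0 a b c : vec3 a b c = 0 -> [/\ a = 0, b = 0 & c = 0].
Proof.
move=> /rowP v0; split.
- by have := v0 0; rewrite vec3E mxE.
- by have := v0 1; rewrite vec3E mxE.
- by have := v0 2; rewrite vec3E mxE.
Qed.

Lemma vec3_eqP v w : v 0 0 = w 0 0 -> v 0 1 = w 0 1 -> v 0 2 = w 0 2 -> v = w.
Proof. by move=> h0 h1 h2; rewrite (vec3_eta v) h0 h1 h2 -vec3_eta. Qed.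

Lemma vec3Z c v : c *: v = vec3 (c * v 0 0) (c * v 0 1) (c * v 0 2).
Proof. by apply: vec3_eqP; rewrite !vec3E mxE. Qed.

Lemma sqnorm3 v : '[v] = `|v 0 0| ^+ 2 + `|v 0 1| ^+ 2 + `|v 0 2| ^+ 2.
Proof.
rewrite dotmx_sum !big_ord_recl big_ord0 addr0 addrA.
by congr (`|v _ _| ^+ 2 + `|v _ _| ^+ 2 + `|v _ _| ^+ 2); apply/val_inj.
Qed.

Lemma sqnorm3_le v i : `|v 0 i| ^+ 2 <= '[v].
Proof.
by rewrite dotmx_sum (bigD1 i)//= lerDl sumr_ge0// => j _; rewrite exprn_ge0.
Qed.

(** Off the coordinate lines, [level v k l] says that the invariant ratio
    [(z0^2 - z1^2 - z2^2) / (2 z1 z2)] is [(l + 1 / l) / 2]; the factor [k] makes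
    the relation polynomial, so that [l = 0] stands for the value infinity. *)
Definition level v k l :=
  v 0 0 ^+ 2 = v 0 1 ^+ 2 + v 0 2 ^+ 2 + k * (1 + l ^+ 2) /\
  v 0 1 * v 0 2 = k * l.

(** With [l = exp(i t)] and [P = l ^ (N - 1)], this is, up to a factor,
    [z0 U : z1 : z2 U + z1 U'] for the Chebyshev values
    [U = sin (N t) / sin t] and [U' = sin ((N - 1) t) / sin t]. *)
Definition Phi v l P : 'rV[C]_3 :=
  vec3 (v 0 0 * (1 - l ^+ 2 * P ^+ 2))
       (v 0 1 * P * (1 - l ^+ 2))
       (v 0 2 * (1 - l ^+ 2 * P ^+ 2) + v 0 1 * l * (1 - P ^+ 2)).

(** One step of [F] doubles the angle, that is [N] becomes [2 N]. *)
Lemma F_Phi v k l P : level v k l ->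
  F_map (Phi v l P) =
  ((1 - l ^+ 2) * (k * (1 - l ^+ 2 * P ^+ 2) + v 0 1 ^+ 2 * (1 - P ^+ 2))) *:
    Phi v l (l * P ^+ 2).
Proof.
case; rewrite vec3Z /F_map -/(vec3 _ _ _) /Phi !vec3E.
move: (v 0 0) (v 0 1) (v 0 2) => a b c ha hb.
congr vec3.
- transitivity (a * (1 - l ^+ 2 * P ^+ 2) *
    (a ^+ 2 * (1 - l ^+ 2 * P ^+ 2) ^+ 2 - b ^+ 2 * P ^+ 2 * (1 - l ^+ 2) ^+ 2
     - c ^+ 2 * (1 - l ^+ 2 * P ^+ 2) ^+ 2
     - 2 * (b * c) * (1 - l ^+ 2 * P ^+ 2) * l * (1 - P ^+ 2)
     - b ^+ 2 * l ^+ 2 * (1 - P ^+ 2) ^+ 2)); first by ring.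
  by rewrite ha hb; ring.
- transitivity (b * P ^+ 2 * (1 - l ^+ 2) ^+ 2 *
    (b * c * (1 - l ^+ 2 * P ^+ 2) + b ^+ 2 * l * (1 - P ^+ 2))); first by ring.
  by rewrite hb; ring.
- transitivity ((c * (1 - l ^+ 2 * P ^+ 2) + b * l * (1 - P ^+ 2)) *
    (a ^+ 2 * (1 - l ^+ 2 * P ^+ 2) ^+ 2
     - c ^+ 2 * (1 - l ^+ 2 * P ^+ 2) ^+ 2
     - 2 * (b * c) * (1 - l ^+ 2 * P ^+ 2) * l * (1 - P ^+ 2)
     - b ^+ 2 * l ^+ 2 * (1 - P ^+ 2) ^+ 2)); first by ring.
  rewrite ha hb.
  apply/eqP; rewrite -subr_eq0; apply/eqP.
  transitivity ((b * c - k * l) * b * (1 - l ^+ 2 * P ^+ 2) * (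
     (1 - l ^+ 2 * P ^+ 2) ^+ 2 - l ^+ 2 * (1 - P ^+ 2) ^+ 2
     - (1 - l ^+ 2) * (1 - P ^+ 2) * (1 + l ^+ 2 * P ^+ 2))); first by ring.
  by rewrite hb subrr !mul0r.
Qed.

Lemma Phi1 v l : Phi v l 1 = (1 - l ^+ 2) *: v.
Proof. by rewrite vec3Z /Phi; congr vec3; ring. Qed.

Lemma indeterminacy_mkproj v : v != 0 -> I (mkproj v) <-> F_map v = 0.
Proof.
move=> v0; have [c c0 cE] := coords_mkproj v0.
rewrite /indeterminacy /= cE F_map_homog; split=> [[_ /eqP]|->].
  by rewrite scaler_eq0 expf_eq0 (negbTE c0) andbF => /eqP.
by rewrite scaler0.
Qed.

(** The value of [P] after [n] steps, that is for [N = 2 ^ n]. *)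
Definition Ppow l n := l ^+ (2 ^ n).-1.

Lemma PpowS l n : Ppow l n.+1 = l * Ppow l n ^+ 2.
Proof.
rewrite /Ppow -exprM -exprS; congr (_ ^+ _).
by rewrite expnS muln2 mul2n; case: (2 ^ n)%N (expn_gt0 2 n) => // m _; rewrite doubleS.
Qed.

Lemma Ppow_sqr l n : l ^+ 2 * Ppow l n ^+ 2 = l ^+ (2 ^ n.+1).
Proof.
rewrite -exprMn /Ppow -exprS prednK ?expn_gt0// -exprM; congr (_ ^+ _).
by rewrite expnS mulnC.
Qed.

(** The condition on [l] excludes the ratios 1 and -1, for which [Phi] vanishes
    identically at [P = 1]. *)
Lemma iter_F v k l n : v != 0 -> level v k l -> l ^+ 2 != 1 ->
  (forall j, (j < n)%N -> ~ I (iter j H (mkproj v))) ->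
  Phi v l (Ppow l n) != 0 /\ iter n H (mkproj v) = mkproj (Phi v l (Ppow l n)).
Proof.
move=> v0 vl l1; have l1' : 1 - l ^+ 2 != 0 by rewrite subr_eq0 eq_sym.
elim: n => [_|n IH nI].
  by rewrite /Ppow expr0 Phi1 mkprojZ// scaler_eq0 negb_or l1'.
have [j jn|P0 nE] := IH; first by apply: nI; rewrite ltnS ltnW.
have := nI n (ltnSn n); rewrite iterS nE => /(indeterminacy_mkproj P0) FP.
rewrite (rational_map_mkproj (@F_map_homog R) P0).
move: FP; rewrite (F_Phi _ vl) -PpowS => /eqP.
by rewrite scaler_eq0 negb_or => /andP[c0 P'0]; rewrite mkprojZ.
Qed.

Lemma iter_F_notE v k l n : v != 0 -> level v k l -> l ^+ 2 != 1 ->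
  ~ E (mkproj v) ->
  Phi v l (Ppow l n) != 0 /\ iter n H (mkproj v) = mkproj (Phi v l (Ppow l n)).
Proof.
move=> v0 vl l1 nE; apply: (iter_F v0 vl l1) => j _.
exact: not_extended_indeterminacy.
Qed.

(** [F] contracts the line z0 = z2 to the point of indeterminacy [-1 : 1 : 0]. *)
Lemma contracted_line v : v != 0 -> v 0 0 = v 0 2 ->
  exists n, I (iter n H (mkproj v)).
Proof.
move=> v0 v02; have [Fv|Fv] := eqVneq (F_map v) 0.
  by exists 0%N; apply/(indeterminacy_mkproj v0).
exists 1%N; rewrite /= (rational_map_mkproj (@F_map_homog R) v0).
by apply/(indeterminacy_mkproj Fv); apply: vec3_eqP; rewrite !mxE /= v02; ring.
Qed.

Lemma sqr_neq1 (l : C) : `|l| < 1 -> l ^+ 2 != 1.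
Proof.
move=> l1; apply: contraTneq l1 => l2; suff -> : `|l| = 1 by rewrite ltxx.
by apply/eqP; rewrite -(@pexpr_eq1 _ _ 2)// -normrX l2 normr1.
Qed.

Lemma expr_small (a s : C) : `|a| < 1 -> 0 < s ->
  exists n, forall m, (n <= m)%N -> `|a ^+ m| <= s.
Proof.
rewrite normc_def -[1](rmorph1 (real_complex R)) ltcR => r1 s0.
set r := Num.sqrt _ in r1.
have sE := gt0_realE s0.
have {}s0 : 0 < complex.Re s by move: s0; rewrite sE ltcR.
have r0 : 0 <= r := sqrtr_ge0 _.
have r1' : `|r| < 1 by rewrite ger0_norm.
have /cvgrPdist_le/(_ _ s0)[n _ nP] := cvg_expr r1'.
exists n => m /nP /=; rewrite sub0r normrN normrX (ger0_norm r0) => rs.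
by rewrite normrX normc_def -/r sE -rmorphXn lecR.
Qed.

(** The points [0 : 1 : -l], where the limit of the iterates degenerates,
    are limits of preimages of the contracted line. With [N = 2 ^ n] and
    [e = l ^ (2 N)], the point [e (l^2 - 1) : l (1 - e^2) : e^2 - l^2] has
    invariant ratio [(l + 1 / l) / 2], and its n-th iterate satisfies z0 = z2. *)
Lemma axis_extended_indeterminacy l : `|l| < 1 -> E (mkproj (vec3 0 1 (- l))).
Proof.
have v3n0 a b : vec3 a 1 b != 0 by apply/eqP => /vec3_eq0[_ /eqP]; rewrite oner_eq0.
have [->|l0] := eqVneq l 0 => l1.
  split => //; apply: subset_closure; apply/bigcup_indeterminacy_upto; split => //.
  exists 0%N; apply/(indeterminacy_mkproj (v3n0 _ _)).
  by apply: vec3_eqP; rewrite !mxE /=; ring.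
have l21 := sqr_neq1 l1.
split => //; apply/closureP => eps e0.
pose u := vec3 0 l (- l ^+ 2).
have uE : mkproj (vec3 0 1 (- l)) = mkproj u.
  by rewrite -(mkprojZ _ l0) vec3Z !vec3E; congr (mkproj (vec3 _ _ _)); ring.
have u0 : u != 0 by apply/eqP => /vec3_eq0[_ /eqP]; rewrite (negbTE l0).
have [s s0 sP] := mkproj_close 2 e0.
have u2 : 0 < '[u] by rewrite dnorm_gt0.
have s60 : 0 < s * '[u] / 6 by rewrite divr_gt0// mulr_gt0.
have [n nP] := expr_small l1 s60.
pose e := l ^+ (2 ^ n.+1).
have es : `|e| <= s * '[u] / 6.
  by apply: nP; rewrite (leq_trans (leqnSn n))// ltnW// ltn_expl.
have e1 : `|e| <= 1 by rewrite normrX exprn_ile1// ltW.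
pose v := vec3 (e * (l ^+ 2 - 1)) (l * (1 - e ^+ 2)) (e ^+ 2 - l ^+ 2).
have [v0 uv] : v != 0 /\ mdist (mkproj u) (mkproj v) < eps.
  apply: sP => //; rewrite sqnorm3 !mxE /=.
  rewrite (_ : 0 - _ = e * (1 - l ^+ 2)); last by ring.
  rewrite (_ : l - _ = e * (l * e)); last by ring.
  rewrite (_ : - l ^+ 2 - _ = e * (- e)); last by ring.
  have ll : `|l| <= 1 by rewrite ltW.
  have sq (x K : C) : `|x| <= K -> 0 <= K -> `|e * x| ^+ 2 <= K ^+ 2 * `|e|.
    move=> xK K0; rewrite normrM exprMn mulrC ler_pM ?exprn_ge0//.
      by rewrite lerXn2r ?nnegrE.
    by rewrite ler_iXnr.
  rewrite (@le_trans _ _ (2 ^+ 2 * `|e| + 1 ^+ 2 * `|e| + 1 ^+ 2 * `|e|))//.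
    apply: lerD; first apply: lerD; apply: sq => //.
    - rewrite (le_trans (ler_normB _ _))// normr1 normrX.
      by rewrite -[leRHS]/(1 + 1) lerD2l exprn_ile1.
    - by rewrite normrM mulr_ile1.
    - by rewrite normrN.
  rewrite (_ : _ + _ = 6 * `|e|); last by ring.
  by rewrite mulrC -ler_pdivlMr.
exists (mkproj v); last by rewrite uE.
apply/bigcup_indeterminacy_upto; split => //.
have vl : level v ((1 - e ^+ 2) * (e ^+ 2 - l ^+ 2)) l.
  by rewrite /level !vec3E; split; ring.
apply: contrapT => nI.
have [//|P0 nE] := @iter_F v _ l n v0 vl l21.
  by move=> j _ Ij; apply: nI; exists j.
apply: nI; suff /(contracted_line P0)[j Ij] : Phi v l (Ppow l n) 0 0 = Phi v l (Ppow l n) 0 2.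
  by exists (j + n)%N; rewrite iterD nE.
rewrite /Phi !vec3E.
rewrite [l * _ * l * _](_ : _ = (1 - e ^+ 2) * (l ^+ 2 - l ^+ 2 * Ppow l n ^+ 2)); last by ring.
by rewrite Ppow_sqr -/e; ring.
Qed.

End Iterates.

(** * Parametrization of points by the invariant ratio *)
Section Levels.
Context (R : realType).
Local Notation C := R[i].
Implicit Types (v w : 'rV[C]_3) (k l : C).

Lemma norm1_inv (l : C) : `|l| = 1 -> l^-1 = l^*%C.
Proof. by move=> l1; rewrite invc_norm l1 expr1n invr1 mul1r. Qed.

Lemma norm1_addV (l : C) : `|l| = 1 -> l + l^-1 = 2 * (complex.Re l)%:C%C.
Proof. by move=> l1; rewrite norm1_inv// addcJ. Qed.

Lemma Re_itv_norm1 (l : C) : `|l| = 1 -> -1 <= complex.Re l <= 1.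
Proof.
move=> l1; rewrite -ler_norml -lecR rmorph1 -l1.
exact: normc_ge_Re.
Qed.

Lemma level_unit v l : `|l| = 1 ->
  v 0 0 ^+ 2 = v 0 1 ^+ 2 + v 0 2 ^+ 2 + 2 * (v 0 1 * v 0 2) * (complex.Re l)%:C%C ->
  level v (v 0 1 * v 0 2 / l) l.
Proof.
rewrite /level => l1 ->; have l0 : l != 0 by rewrite -normr_eq0 l1 oner_eq0.
split; last by rewrite divfK.
rewrite -mulrA [_ * _%:C%C]mulrC mulrA -(norm1_addV l1).
by field.
Qed.

Lemma circle_point (x : R) : -1 <= x <= 1 ->
  exists2 l : C, `|l| = 1 & complex.Re l = x.
Proof.
move=> x1; have x2 : x ^+ 2 <= 1 by rewrite -real_normK ?num_real// expr_le1// ler_norml.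
exists (x +i* Num.sqrt (1 - x ^+ 2))%C => //.
rewrite normc_def /= sqr_sqrtr; last by rewrite subr_ge0.
by rewrite addrC subrK sqrtr1.
Qed.

(** The two solutions of [(l + 1 / l) / 2 = x] have product 1: either one of them
    is in the open unit disk, or both are on the unit circle and [x] is their
    common real part. *)
Lemma level_dichotomy v :
  (exists2 x : R, -1 <= x <= 1 &
     v 0 0 ^+ 2 = v 0 1 ^+ 2 + v 0 2 ^+ 2 + 2 * (v 0 1 * v 0 2) * x%:C%C) \/
  (exists k l, [/\ k != 0, `|l| < 1 & level v k l]).
Proof.
pose q := v 0 0 ^+ 2 - v 0 1 ^+ 2 - v 0 2 ^+ 2.
have qE : v 0 0 ^+ 2 = v 0 1 ^+ 2 + v 0 2 ^+ 2 + q by rewrite /q; ring.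
have [m0|m0] := eqVneq (v 0 1 * v 0 2) 0.
  have [q0|q0] := eqVneq q 0.
    by left; exists 0; rewrite ?lerN10 ?ler01// qE m0 q0 mulr0 ?mul0r.
  by right; exists q, 0; split; rewrite ?normr0// /level m0 qE; split; ring.
pose w := q / (v 0 1 * v 0 2); pose s := sqrtC (w ^+ 2 - 4).
have ss : s ^+ 2 = w ^+ 2 - 4 by rewrite sqrtCK.
have small l l' : l + l' = w -> l * l' = 1 -> `|l| < 1 ->
    exists k l, [/\ k != 0, `|l| < 1 & level v k l].
  move=> lw ll l1; have l0 : l != 0 by apply: contraNneq (oner_neq0 C) => l0; rewrite -ll l0 mul0r.
  exists (v 0 1 * v 0 2 / l), l; split => //; first by rewrite mulf_neq0// invr_eq0.
  split; last by rewrite divfK.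
  have -> : l = w - l' by rewrite -lw addrK.
  rewrite qE; congr (_ + _).
  have l'E : l' = l^-1 by rewrite -[LHS]mul1r -(mulVf l0) -mulrA ll mulr1.
  have -> : w - l' = l by rewrite -lw addrK.
  rewrite -(divfK m0 q) -/w -lw l'E; field.
  by move: m0; rewrite mulf_eq0 negb_or => /andP[m1 m2]; rewrite ?l0 ?m1 ?m2.
pose l := (w + s) / 2; pose l' := (w - s) / 2.
have half_sum (a b : C) : (a + b) / 2 + (a - b) / 2 = a by field.
have half_mul (a b : C) : (a + b) / 2 * ((a - b) / 2) = (a ^+ 2 - b ^+ 2) / 4 by field.
have lw : l + l' = w by exact: half_sum.
have ll : l * l' = 1.
  rewrite /l /l' half_mul ss (_ : w ^+ 2 - _ = 4); last by ring.
  by rewrite divff// pnatr_eq0.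
have [l1|l1] := real_ltP (normr_real l) (@real1 C); first by right; exact: (small l l').
have [l1'|l1'] := real_ltP (normr_real l') (@real1 C).
  by right; apply: (small l' l) => //; [rewrite addrC|rewrite mulrC].
have nn : `|l| * `|l'| = 1 by rewrite -normrM ll normr1.
have n1 : `|l| = 1.
  apply/eqP; rewrite eq_le l1 andbT -nn ler_peMr//.
left; exists (complex.Re l); first exact: Re_itv_norm1.
rewrite qE -mulrA [_ * _%:C%C]mulrC mulrA -(norm1_addV n1).
have -> : l^-1 = l'.
  have l0 : l != 0 by rewrite -normr_eq0 n1 oner_eq0.
  by rewrite -[RHS]mul1r -(mulVf l0) -mulrA ll mulr1.
by rewrite lw /w divfK.
Qed.

Lemma level_exists v : exists k l, `|l| <= 1 /\ level v k l.
Proof.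
have [[x x1 vx]|[k [l [_ l1 vl]]]] := level_dichotomy v; last by exists k, l; rewrite ltW.
have [l l1 lx] := circle_point x1.
by exists (v 0 1 * v 0 2 / l), l; rewrite l1; split => //; apply: level_unit; rewrite ?lx.
Qed.

Definition cis (t : R) : C := (cos t +i* sin t)%C.

Lemma cisD t t' : cis (t + t') = cis t * cis t'.
Proof. by rewrite /cis cosD sinD /GRing.mul /= addrC [X in (_ +i* X)%C]addrC. Qed.

Lemma cisX t n : cis t ^+ n = cis (n%:R * t).
Proof.
elim: n => [|n IH]; first by rewrite expr0 mul0r /cis cos0 sin0.
by rewrite exprS IH -cisD -nat1r mulrDl mul1r.
Qed.

Lemma cis_norm t : `|cis t| = 1.
Proof. by rewrite normc_def /= cos2Dsin2 sqrtr1. Qed.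

(** The angles are odd multiples of pi / 2^(n+1): they get arbitrarily close to
    any angle, and being odd excludes [l = 1] and [l = -1]. *)
Lemma dyadic_root (x tau : R) : -1 <= x <= 1 -> 0 < tau ->
  exists l : C, exists n, [/\ `|l| = 1, l ^+ (2 ^ n) = 1, l ^+ 2 != 1 &
    `|complex.Re l - x| <= tau].
Proof.
move=> x1 tau0; pose t := acos x.
have xE : cos t = x by rewrite acosK// in_itv.
have t0 : 0 <= t by rewrite acos_ge0.
have /cvgrPdist_le/(_ _ tau0) := @continuous_cos R t.
move=> /nbhs_ballP[d /= d0 dP].
have pi0 := @pi_gt0 R.
have [n nP] : exists n : nat, pi / d < n%:R.
  by exists (Num.truncn (pi / d)).+1; rewrite truncnS_gt.
pose N : R := 2 ^+ n; have N0 : 0 < N by rewrite exprn_gt0.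
have nN : n%:R < N by rewrite /N -natrX ltr_nat ltn_expl.
have pN : pi / N < d.
  rewrite ltr_pdivrMr// mulrC -ltr_pdivrMr//; exact: lt_trans nN.
pose j := Num.truncn (t * N / pi).
have /andP[jl ju] : j%:R <= t * N / pi < j.+1%:R.
  by apply: truncn_itv; rewrite divr_ge0 ?mulr_ge0// ltW.
pose t' := pi * (2 * j%:R + 1) / (2 * N).
have lE : cis t' ^+ (2 ^ n.+1) = -1.
  rewrite cisX expnS natrM natrX -/N.
  rewrite (_ : _ * t' = (2 * j + 1)%:R * pi); last first.
    by rewrite /t' natrD natrM; field; rewrite gt_eqF.
  rewrite -cisX /cis cospi sinpi.
  have -> : (-1 +i* 0)%C = -1 :> C by apply/eqP; rewrite eq_complex /= oppr0 !eqxx.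
  by rewrite addn1 -signr_odd /= mul2n odd_double.
exists (cis t'), n.+2; split; first exact: cis_norm.
- by rewrite [(2 ^ n.+2)%N]expnS mulnC exprM lE sqrrN expr1n.
- apply/eqP => l2; move: lE; rewrite expnS exprM l2 expr1n => /eqP.
  by rewrite -subr_eq0 opprK -mulr2n pnatr_eq0.
- rewrite -xE distrC; apply: dP; rewrite /ball /= ltr_norml.
  move: jl ju; rewrite ler_pdivlMr// ltr_pdivrMr// -natr1 => jl ju.
  have t'N : t' * N = pi * j%:R + pi / 2 by rewrite /t'; field; rewrite gt_eqF.
  move: pN; rewrite ltr_pdivrMr// => pN.
  by apply/andP; split; rewrite -(ltr_pM2r N0); nra.
Qed.

(** The points are [r w] with [w] on the unit circle and [r < 1] close to 1. *)
Lemma disk_approx (x tau : R) : -1 <= x <= 1 -> 0 < tau ->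
  exists l : C, [/\ l != 0, `|l| < 1 & `|(l + l^-1) / 2 - x%:C%C| <= tau%:C%C].
Proof.
move=> x1 tau0; have [w w1 wx] := circle_point x1.
have w0 : w != 0 by rewrite -normr_eq0 w1 oner_eq0.
pose t := Num.min (1 / 2) (tau / 2).
have t0 : 0 < t by rewrite lt_min divr_gt0//= divr_gt0.
have t12 : t <= 1 / 2 by rewrite ge_min lexx.
have tt : t <= tau / 2 by rewrite ge_min lexx orbT.
pose r := 1 - t; have r0 : 0 < r by rewrite /r; lra.
pose rc : C := r%:C%C; have rc0 : 0 < rc by rewrite ltcR.
have rcn : rc != 0 by rewrite gt_eqF.
exists (rc * w); split; first by rewrite mulf_neq0.
  by rewrite normrM w1 mulr1 gtr0_norm// -[1](rmorph1 (real_complex R)) ltcR /r; lra.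
have -> : (rc * w + (rc * w)^-1) / 2 - x%:C%C = ((rc - 1) * w + (rc^-1 - 1) * w^-1) / 2.
  have -> : x%:C%C = (w + w^-1) / 2 by rewrite norm1_addV// wx; field.
  by field; rewrite w0 rcn.
rewrite normrM normfV [`|2|]ger0_norm// ler_pdivrMr//.
rewrite (le_trans (ler_normD _ _))// !normrM normfV w1 invr1 !mulr1.
have -> : rc - 1 = (- t)%:C%C.
  by rewrite -[1](rmorph1 (real_complex R)) -rmorphB; congr (_%:C)%C; rewrite /r; ring.
have -> : rc^-1 - 1 = (t / r)%:C%C.
  rewrite -[1](rmorph1 (real_complex R)) -fmorphV -rmorphB; congr (_%:C)%C.
  by rewrite /r; field; rewrite -/r gt_eqF.
rewrite rmorphN normrN !ger0_norm ?lecR ?divr_ge0 ?(ltW t0) ?(ltW r0)//.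
have -> : tau%:C%C * 2 = (tau * 2)%:C%C by rewrite rmorphM /= rmorph_nat.
rewrite -rmorphD lecR.
have : t / r <= 2 * t by rewrite ler_pdivrMr// /r; nra.
by move=> h; apply: (le_trans (lerD (lexx t) h)); lra.
Qed.

End Levels.

(** * The Fatou set and the Julia set of F *)
Section Equicontinuity.
Context (R : realType).
Local Notation C := R[i].
Implicit Types (v w : 'rV[C]_3) (k l : C).
Local Notation "''[' u ]" := (dotmx u u) : ring_scope.
Local Notation H := (rational_map (@F_map R)).
Local Notation I := (indeterminacy (@F_map R) setT).
Local Notation E := (extended_indeterminacy (@F_map R) setT).

Section Lipschitz.
Context (v : 'rV[C]_3) (l r : C).
Hypothesis r1 : r < 1.
Hypothesis lr : `|l| <= r.

Definition param_near (d : C) w l' :=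
  [/\ forall i, `|v 0 i - w 0 i| <= d, `|l - l'| <= d & `|l'| <= r].

(** Boundedness at the base point and Lipschitz continuity there, uniformly
    in the index [n]. *)
Definition unif_lipschitz (f : 'rV[C]_3 -> C -> nat -> C) :=
  exists2 K : C, 0 <= K & forall d w l' n, 0 <= d -> d <= 1 -> param_near d w l' ->
    `|f v l n| <= K /\ `|f v l n - f w l' n| <= K * d.

Lemma lip_cst a : unif_lipschitz (fun _ _ _ => a).
Proof.
exists `|a| => // d w l' n d0 _ _; split => //.
by rewrite subrr normr0 mulr_ge0.
Qed.

Lemma lip_coord i : unif_lipschitz (fun w _ _ => w 0 i).
Proof.
exists (`|v 0 i| + 1) => [|d w l' n d0 _ [vw _ _]]; first by rewrite addr_ge0.
split; first by rewrite lerDl.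
by rewrite (le_trans (vw i))// ler_peMl// lerDr.
Qed.

Lemma lipD f g : unif_lipschitz f -> unif_lipschitz g ->
  unif_lipschitz (fun w l' n => f w l' n + g w l' n).
Proof.
move=> [K K0 Kf] [K' K'0 Kg]; exists (K + K') => [|d w l' n d0 d1 near]; first exact: addr_ge0.
have [f1 f2] := Kf _ _ _ n d0 d1 near; have [g1 g2] := Kg _ _ _ n d0 d1 near.
split; first by rewrite (le_trans (ler_normD _ _))// lerD.
by rewrite opprD addrACA (le_trans (ler_normD _ _))// mulrDl lerD.
Qed.

Lemma lipM f g : unif_lipschitz f -> unif_lipschitz g ->
  unif_lipschitz (fun w l' n => f w l' n * g w l' n).
Proof.
move=> [K K0 Kf] [K' K'0 Kg].
exists (K * K' + (K * K' + (K + K) * K')) => [|d w l' n d0 d1 near].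
  by rewrite !addr_ge0// mulr_ge0// addr_ge0.
have [f1 f2] := Kf _ _ _ n d0 d1 near; have [g1 g2] := Kg _ _ _ n d0 d1 near.
split; first by rewrite normrM ler_wpDr ?ler_pM// addr_ge0// mulr_ge0// addr_ge0.
set a := f v l n in f1 f2 *; set b := g v l n in g1 g2 *.
rewrite (_ : _ - _ = a * (b - g w l' n) + (a - f w l' n) * b
  - (a - f w l' n) * (b - g w l' n)); last by ring.
rewrite (le_trans (ler_normB _ _))// (le_trans (lerD (ler_normD _ _) (lexx _)))//.
rewrite !normrM.
have e1 : `|a| * `|b - g w l' n| <= K * (K' * d) by rewrite ler_pM.
have e2 : `|a - f w l' n| * `|b| <= K * d * K' by rewrite ler_pM.
have e3 : `|a - f w l' n| * `|b - g w l' n| <= K * d * K'.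
  by rewrite ler_pM// (le_trans g2)// ler_piMr.
rewrite (le_trans (lerD (lerD e1 e2) e3))//.
rewrite -subr_ge0 (_ : _ - _ = K * K' * d); last by ring.
by rewrite !mulr_ge0.
Qed.

(** Uniformity in the exponent comes from the geometric series. *)
Lemma lip_pow (e : nat -> nat) : unif_lipschitz (fun _ l' n => l' ^+ e n).
Proof.
have r0 : 0 <= r by rewrite (le_trans _ lr).
have r10 : 0 < 1 - r by rewrite subr_gt0.
exists (1 + (1 - r)^-1) => [|d w l' n d0 d1 [_ ll' l'r]].
  by rewrite addr_ge0// invr_ge0 ltW.
have lr1 : `|l| <= 1 by rewrite (le_trans lr)// ltW.
split.
  by rewrite normrX ler_wpDr ?invr_ge0 ?(ltW r10)// exprn_ile1.
have sumr m : \sum_(i < m) r ^+ i <= (1 - r)^-1.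
  rewrite -(ler_pM2l r10) mulfV ?gt_eqF// -opprB mulNr -subrX1 opprB.
  by rewrite lerBlDr lerDl exprn_ge0.
rewrite subrXX normrM [leRHS]mulrC; apply: ler_pM => //.
rewrite (le_trans (ler_norm_sum _ _ _))// ler_wpDl//.
apply: le_trans (sumr (e n)); apply: ler_sum => i _.
rewrite normrM !normrX -[leRHS]mul1r.
by rewrite ler_pM ?exprn_ge0 ?exprn_ile1// lerXn2r ?nnegrE.
Qed.

Lemma lipN f : unif_lipschitz f -> unif_lipschitz (fun w l' n => - f w l' n).
Proof.
move=> [K K0 Kf]; exists K => // d w l' n d0 d1 near.
have [f1 f2] := Kf _ _ _ n d0 d1 near.
by rewrite normrN -opprD normrN.
Qed.

Lemma Phi_lipschitz : exists2 K : C, 0 <= K & forall d w l' n, 0 <= d -> d <= 1 ->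
  param_near d w l' ->
  '[Phi v l (Ppow l n) - Phi w l' (Ppow l' n)] <= K * d.
Proof.
have P2 := lipM (lip_pow (fun=> 2%N))
  (lipM (lip_pow (fun n => (2 ^ n).-1)) (lip_pow (fun n => (2 ^ n).-1))).
have A := lipD (lip_cst 1) (lipN P2).
have [K0 K00 L0] := lipM (lip_coord 0) A.
have [K1 K10 L1] := lipM (lipM (lip_coord 1) (lip_pow (fun n => (2 ^ n).-1)))
  (lipD (lip_cst 1) (lipN (lip_pow (fun=> 2%N)))).
have [K2 K20 L2] := lipD (lipM (lip_coord 2) A)
  (lipM (lipM (lip_coord 1) (lip_pow (fun=> 1%N)))
     (lipD (lip_cst 1) (lipN (lipM (lip_pow (fun n => (2 ^ n).-1))
        (lip_pow (fun n => (2 ^ n).-1)))))).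
exists (K0 ^+ 2 + K1 ^+ 2 + K2 ^+ 2) => [|d w l' n d0 d1 near].
  by rewrite !addr_ge0// exprn_ge0.
have [_ {}L0] := L0 _ _ _ n d0 d1 near.
have [_ {}L1] := L1 _ _ _ n d0 d1 near.
have [_ {}L2] := L2 _ _ _ n d0 d1 near.
have sq (x K : C) : 0 <= K -> `|x| <= K * d -> `|x| ^+ 2 <= K ^+ 2 * d.
  move=> Kp xK; rewrite (@le_trans _ _ ((K * d) ^+ 2))//.
    by rewrite lerXn2r ?nnegrE ?mulr_ge0.
  by rewrite exprMn ler_wpM2l ?exprn_ge0// ler_iXnr.
rewrite sqnorm3 !mulrDl; apply: lerD; first apply: lerD.
- by apply: sq => //; rewrite !mxE.
- by apply: sq => //; rewrite !mxE.
- by apply: sq => //; rewrite !mxE.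
Qed.

End Lipschitz.

Lemma common_lower_bound (x y : C) : 0 < x -> 0 < y ->
  exists d, [/\ 0 < d, d <= x & d <= y].
Proof.
move=> x0 y0; have xy : 0 < x + y by rewrite addr_gt0.
exists (x * y / (x + y)); split; first by rewrite divr_gt0// mulr_gt0.
- by rewrite ler_pdivrMr// ler_pM2l// lerDr ltW.
- by rewrite ler_pdivrMr// mulrC ler_pM2l// lerDl ltW.
Qed.

(** The parameter [l] depends continuously on the point: if [y] and [y'] are
    the values of [l / (1 + l^2)] at [l] and [l'] then
    [(l - l') (1 - l l') = (y - y') (1 + l^2) (1 + l'^2)]. *)
Lemma level_perturb v k l d : level v k l -> k != 0 -> `|l| < 1 -> 0 < d ->
  exists2 eta, 0 < eta & forall w, (forall i, `|v 0 i - w 0 i| <= eta) ->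
    exists k' l', level w k' l' /\ `|l - l'| <= d.
Proof.
move=> [vq vm] k0 l1 d0.
have sqr i := lipM (lip_coord v l `|l| i) (lip_coord v l `|l| i).
have [K K0 LK] := lipD (lipD (sqr 0) (lipN (sqr 1))) (lipN (sqr 2)).
have [K' K'0 LK'] := lipM (lip_coord v l `|l| 1) (lip_coord v l `|l| 2).
pose q := k * (1 + l ^+ 2); pose m := k * l.
have qE : q = v 0 0 * v 0 0 - v 0 1 * v 0 1 - v 0 2 * v 0 2.
  by rewrite /q -expr2 vq; ring.
have kn : 0 < `|k| by rewrite normr_gt0.
have l1' : 0 < 1 - `|l| by rewrite subr_gt0.
have qn : 0 < `|q|.
  rewrite normr_gt0 mulf_neq0//; apply: contraTneq l1 => /eqP.
  rewrite addrC addr_eq0 => /eqP l2; suff -> : `|l| = 1 by rewrite ltxx.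
  by apply/eqP; rewrite -(@pexpr_eq1 _ _ 2)// -normrX l2 normrN1.
(* [a] makes [q] keep half its modulus, [b] makes [l] move by at most [d] *)
pose a := 2 * K / `|q|.
pose b := 4 * (`|m| * K + `|q| * K') / (`|k| * `|q| * (1 - `|l|) * d).
have a0 : 0 <= a by rewrite divr_ge0// mulr_ge0.
have D0 : 0 < `|k| * `|q| * (1 - `|l|) * d by rewrite !mulr_gt0.
have b0 : 0 <= b by rewrite divr_ge0 ?(ltW D0)// mulr_ge0// addr_ge0// mulr_ge0.
have ab0 : 0 < 1 + a + b by rewrite -addrA ltr_pwDl// addr_ge0.
pose eta := (1 + a + b)^-1.
have e0 : 0 < eta by rewrite invr_gt0.
have ubound x : x <= 1 + a + b -> x * eta <= 1.
  by move=> xab; rewrite ler_pdivrMr// mul1r.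
have e1 : eta <= 1.
  by rewrite -[eta]mul1r ubound// -addrA lerDl addr_ge0.
have ae : a * eta <= 1 by apply: ubound; rewrite addrAC lerDr addr_ge0.
have be : b * eta <= 1 by apply: ubound; rewrite lerDr addr_ge0.
exists eta => // w vw; have [k' [l' [l'1 [wq wm]]]] := level_exists w.
exists k', l'; split; first by split.
have near : param_near v l `|l| eta w l by split; rewrite ?subrr ?normr0 ?(ltW e0).
have [_ {}LK] := LK _ _ _ 0%N (ltW e0) e1 near.
have [_ {}LK'] := LK' _ _ _ 0%N (ltW e0) e1 near.
pose q' := k' * (1 + l' ^+ 2); pose m' := k' * l'.
have q'E : q' = w 0 0 * w 0 0 - w 0 1 * w 0 1 - w 0 2 * w 0 2.
  by rewrite /q' -expr2 wq; ring.
rewrite -qE -q'E in LK; rewrite vm wm -/m -/m' in LK'.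
have q'n : `|q| / 2 <= `|q'|.
  have : K * eta <= `|q| / 2.
    move: ae; rewrite /a mulrAC ler_pdivrMr// mul1r => ae.
    by rewrite ler_pdivlMr// mulrC mulrA.
  move=> /(le_trans LK) qq; have := lerB_dist q q'.
  rewrite lerBlDr => /le_trans; move=> /(_ _ (lerD qq (lexx _))).
  by rewrite -lerBlDl [X in X - _](splitr `|q|) addrK.
have k'n : `|q| / 4 <= `|k'|.
  have : `|q'| <= `|k'| * 2.
    rewrite normrM ler_wpM2l// (le_trans (ler_normD _ _))// normr1 normrX.
    by rewrite -[leRHS]/(1 + 1) lerD2l exprn_ile1.
  move=> /(le_trans q'n); rewrite -ler_pdivrMr//.
  by rewrite (_ : `|q| / 2 / 2 = `|q| / 4)//; field.
have main : `|l - l'| * (1 - `|l|) * `|k| * `|k'| <= (`|m| * K + `|q| * K') * eta.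
  have nn : 1 - `|l| <= `|1 - l * l'|.
    rewrite (le_trans _ (lerB_dist _ _))// normr1 lerD2l lerN2 normrM.
    by rewrite ler_piMr.
  rewrite (@le_trans _ _ (`|l - l'| * `|1 - l * l'| * `|k| * `|k'|))//.
    by rewrite -!mulrA ler_wpM2l// ler_wpM2r// mulr_ge0.
  rewrite -!normrM.
  rewrite (_ : _ * k' = (m - m') * q - m * (q - q')); last first.
    by rewrite /m /m' /q /q'; ring.
  rewrite (le_trans (ler_normB _ _))// (normrM (m - m')) (normrM m) addrC mulrDl.
  apply: lerD; first by rewrite -mulrA ler_wpM2l.
  by rewrite mulrC -mulrA ler_wpM2l.
have : `|l - l'| * (1 - `|l|) * `|k| * (`|q| / 4) <= (`|m| * K + `|q| * K') * eta.
  rewrite (le_trans _ main)// ler_wpM2l// !mulr_ge0// ltW//.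
move: be; rewrite /b mulrAC ler_pdivrMr// mul1r => be le4.
have lek : 0 < `|k| * `|q| * (1 - `|l|) by rewrite !mulr_gt0.
rewrite -(ler_pM2l lek) (le_trans _ be)//.
rewrite (_ : _ * `|l - l'| = 4 * (`|l - l'| * (1 - `|l|) * `|k| * (`|q| / 4))); last by field.
by rewrite -[leRHS]mulrA ler_pM2l.
Qed.

Lemma one_sub_norm (x : C) : 1 - `|x| <= `|1 - x|.
Proof. by rewrite (le_trans _ (lerB_dist _ _))// normr1. Qed.

(** The iterates can only degenerate at the points [0 : 1 : -l]: when z0 = 0
    the level relation factors as [(z2 + l z1) (l z2 + z1) = 0]. *)
Lemma Phi_lower_bound v k l : v != 0 -> level v k l -> `|l| < 1 -> ~ E (mkproj v) ->
  exists2 c : C, 0 < c & forall n, c <= '[Phi v l (Ppow l n)].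
Proof.
move=> v0 [vq vm] l1 nE; have l1' : 0 < 1 - `|l| by rewrite subr_gt0.
have lpow n : (0 < n)%N -> 1 - `|l| <= `|1 - l ^+ n|.
  move=> n0; rewrite (le_trans _ (one_sub_norm _))// lerD2l lerN2 normrX.
  by rewrite ler_iXnr// ltW.
have [z0|z0] := eqVneq (v 0 0) 0; last first.
  exists ((`|v 0 0| * (1 - `|l|)) ^+ 2) => [|n].
    by rewrite exprn_gt0// mulr_gt0// normr_gt0.
  rewrite (le_trans _ (sqnorm3_le _ 0))// vec3E normrM.
  rewrite lerXn2r ?nnegrE ?mulr_ge0 ?(ltW l1')//.
  by rewrite ler_wpM2l// Ppow_sqr lpow// expn_gt0.
have /eqP : (v 0 2 + l * v 0 1) * (l * v 0 2 + v 0 1) = 0.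
  rewrite (_ : _ * _ = l * (v 0 1 ^+ 2 + v 0 2 ^+ 2) + v 0 1 * v 0 2 * (1 + l ^+ 2)); last by ring.
  rewrite vm (_ : _ + _ = l * (v 0 1 ^+ 2 + v 0 2 ^+ 2 + k * (1 + l ^+ 2))); last by ring.
  by rewrite -vq z0 expr0n mulr0.
rewrite mulf_eq0 => /orP[|]; rewrite addrC addr_eq0 => /eqP.
  move=> /esym/eqP; rewrite eqr_oppLR => /eqP z2; exfalso; apply: nE.
  have z1 : v 0 1 != 0.
    apply: contraNneq v0 => z1; rewrite (vec3_eta v) z0 z2 z1 mulr0 oppr0.
    by apply/eqP/vec3_eqP; rewrite !vec3E mxE.
  have -> : v = v 0 1 *: vec3 0 1 (- l).
    by apply: vec3_eqP; rewrite vec3Z !vec3E ?mulr0 ?mulr1// mulrN mulrC.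
  by rewrite mkprojZ//; exact: axis_extended_indeterminacy.
move=> z1; have z2 : v 0 2 != 0.
  apply: contraNneq v0 => z2; rewrite (vec3_eta v) z0 z1 z2 mulr0 oppr0.
  by apply/eqP/vec3_eqP; rewrite !vec3E mxE.
exists ((`|v 0 2| * (1 - `|l|)) ^+ 2) => [|n].
  by rewrite exprn_gt0// mulr_gt0// normr_gt0.
rewrite (le_trans _ (sqnorm3_le _ 2))// vec3E z1.
rewrite (_ : _ + _ = v 0 2 * (1 - l ^+ 2)); last by ring.
by rewrite normrM lerXn2r ?nnegrE ?mulr_ge0 ?(ltW l1')// ler_wpM2l// lpow.
Qed.

(** Off the spectrum the parameter [l] stays in a compact part of the open unit
    disk near the point, so that all powers of [l] are Lipschitz with a common
    constant, while [Phi] stays away from 0. *)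
Theorem fatou_level v k l : v != 0 -> level v k l -> k != 0 -> `|l| < 1 ->
  ~ E (mkproj v) -> fatou (@F_map R) setT (mkproj v).
Proof.
move=> v0 vl k0 l1 nE; apply/fatouP; split => // eps e0.
have [s s0 sP] := mkproj_close 2 e0.
have [c c0 cP] := Phi_lower_bound v0 vl l1 nE.
pose r := (1 + `|l|) / 2.
have r1 : r < 1 by rewrite ltr_pdivrMr// mul1r -[ltRHS]/(1 + 1) ltrD2l.
have lr : `|l| <= r.
  by rewrite ler_pdivlMr// mulr_natr mulr2n lerD2r ltW.
have [K K0 KP] := Phi_lipschitz v r1 lr.
have K1 : 0 < K + 1 by rewrite ltr_wpDl.
have rl : 0 < r - `|l|.
  by rewrite subr_gt0 ltr_pdivlMr// mulr_natr mulr2n ltrD2r.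
have [d1 [d10 d1r d11]] := common_lower_bound rl (@ltr01 C).
have sc0 : 0 < s * c / (K + 1) by rewrite divr_gt0// mulr_gt0.
have [d [d0 dd1 dsc]] := common_lower_bound d10 sc0.
have Kd : K * d <= s * c.
  rewrite (le_trans (_ : _ <= (K + 1) * d))//.
    by rewrite ler_pM2r// lerDl.
  by rewrite mulrC -ler_pdivlMr.
have [eta eta0 etaP] := level_perturb vl k0 l1 d0.
have [t [t0 teta td]] := common_lower_bound eta0 d0.
have v2 : 0 < '[v] by rewrite dnorm_gt0.
have s'0 : 0 < t ^+ 2 / '[v] by rewrite divr_gt0// exprn_gt0.
have [e e_gt0 eP] := close_representative 2 s'0.
exists e => // n q _ nEq /(eP _ _ v0)[w [w0 qw]]; rewrite divfK ?gt_eqF// => vw.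
have vwi i : `|v 0 i - w 0 i| <= t.
  rewrite -(@ler_pXn2r _ 2) ?nnegrE ?(ltW t0)//.
  by apply: le_trans vw; apply: le_trans (sqnorm3_le _ i); rewrite !mxE.
have [k' [l' [wl ll']]] : exists k' l', level w k' l' /\ `|l - l'| <= d.
  by apply: etaP => i; rewrite (le_trans (vwi i)).
have l'r : `|l'| <= r.
  have := ler_normB l (l - l'); rewrite opprB addrCA subrr addr0 => /le_trans; apply.
  by rewrite -lerBrDl (le_trans ll')// (le_trans dd1).
have l'1 := le_lt_trans l'r r1.
rewrite qw in nEq *.
have [P0 ->] := iter_F_notE n v0 vl (sqr_neq1 l1) nE.
have [P'0 ->] := iter_F_notE n w0 wl (sqr_neq1 l'1) nEq.
apply: (sP _ _ P0 _).2; rewrite (le_trans (KP d w l' n _ _ _)) ?(ltW d0)//.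
- by rewrite (le_trans dd1).
- by split => // i; rewrite (le_trans (vwi i)).
- by apply: (le_trans Kd); rewrite ler_pM2l.
Qed.

End Equicontinuity.

Section Nonequicontinuity.
Context (R : realType).
Local Notation C := R[i].
Implicit Types (u v w : 'rV[C]_3) (k l : C).
Local Notation "''[' u ]" := (dotmx u u) : ring_scope.
Local Notation H := (rational_map (@F_map R)).
Local Notation I := (indeterminacy (@F_map R) setT).
Local Notation E := (extended_indeterminacy (@F_map R) setT).

(** One of the two square roots of [c] is close to [z], as
    [(z - b) (z + b) = z^2 - b^2]. *)
Lemma nearby_sqrt (z c : C) : exists2 a, a ^+ 2 = c & `|z - a| ^+ 2 <= `|z ^+ 2 - c|.
Proof.
pose b := sqrtC c; have bE : b ^+ 2 = c by rewrite sqrtCK.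
have [h|h] := real_leP (normr_real (z - b)) (normr_real (z + b)).
  by exists b => //; rewrite -bE subr_sqr normrM expr2 ler_wpM2l.
exists (- b); first by rewrite sqrrN.
by rewrite opprK -bE subr_sqr normrM expr2 ler_wpM2r// ltW.
Qed.

(** The coordinate z0 enters the invariant ratio through its square only, so
    adjusting it alone, by [nearby_sqrt], produces all nearby ratios. *)
Lemma nearby_ratio v (x : C) (d : R) : v != 0 -> 0 < d ->
  v 0 0 ^+ 2 = v 0 1 ^+ 2 + v 0 2 ^+ 2 + 2 * (v 0 1 * v 0 2) * x ->
  exists2 tau : R, 0 < tau & forall x' : C, `|x' - x| <= tau%:C%C ->
    exists a, [/\ vec3 a (v 0 1) (v 0 2) != 0,
      mdist (mkproj v) (mkproj (vec3 a (v 0 1) (v 0 2))) < d &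
      a ^+ 2 = v 0 1 ^+ 2 + v 0 2 ^+ 2 + 2 * (v 0 1 * v 0 2) * x'].
Proof.
move=> v0 d0 vx; have [s s0 sP] := mkproj_close 2 d0.
have v2 : 0 < '[v] by rewrite dnorm_gt0.
pose M := `|2 * (v 0 1 * v 0 2)|.
have M0 : 0 <= M by exact: normr_ge0.
have M1 : 0 < M + 1 by rewrite ltr_wpDl.
pose tc := s * '[v] / (M + 1).
have tc0 : 0 < tc by rewrite divr_gt0// mulr_gt0.
have tcE := gt0_realE tc0.
exists (complex.Re tc); first by rewrite -ltcR -tcE.
move=> x'; rewrite -tcE => xx'.
have [a aE av] := nearby_sqrt (v 0 0)
  (v 0 1 ^+ 2 + v 0 2 ^+ 2 + 2 * (v 0 1 * v 0 2) * x').
have /(sP _ _ v0)[w0 vw] : '[v - vec3 a (v 0 1) (v 0 2)] <= s * '[v].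
  rewrite sqnorm3 !mxE /= !subrr normr0 expr0n !addr0.
  rewrite (le_trans av)// vx.
  rewrite (_ : _ - _ = 2 * (v 0 1 * v 0 2) * (x - x')); last by ring.
  rewrite normrM distrC -/M (le_trans (ler_wpM2l M0 xx'))//.
  rewrite /tc mulrA ler_pdivrMr// mulrC ler_pM2l ?mulr_gt0//.
  by rewrite lerDl.
by exists a; rewrite aE.
Qed.

Lemma acos_45_gt0 : 0 < acos (4 / 5 : R).
Proof. by rewrite acos_gt0//; apply/andP; split; lra. Qed.

(** The cosine of the distance from [0 : 1 : -1] to a point with [z1 = 0] is at
    most [1 / sqrt 2]; the constants leave room for a small [z1]. *)
Lemma far_from_contracted u : u != 0 -> 100 * `|u 0 1| ^+ 2 <= '[u] ->
  acos (4 / 5 : R) <= mdist (mkproj (vec3 0 1 (-1) : 'rV[C]_3)) (mkproj u).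
Proof.
move=> u0 u1; have w0 : vec3 0 1 (-1) != 0 :> 'rV[C]_3.
  by apply/eqP => /vec3_eq0[_ /eqP]; rewrite oner_eq0.
rewrite mdist_mkproj// leNgt ltr_acos; last 2 first.
- have /andP[h ->] := Re_dot_cos_itv w0 u0.
  by rewrite (le_trans _ h)// lerN10.
- by rewrite acos_ge0 ?acos_lepi//; apply/andP; split; lra.
rewrite acosK; last by rewrite in_itv /=; apply/andP; split; lra.
rewrite -leNgt -lecR -dot_cos_realE.
rewrite -(@ler_pXn2r _ 2) ?nnegrE ?dot_cos_ge0//; last first.
  by rewrite ler0c divr_ge0.
have u2 : 0 < '[u] by rewrite dnorm_gt0.
have sqw : '[vec3 0 1 (-1) : 'rV[C]_3] = 2.
  by rewrite sqnorm3 !vec3E normrN normr1 normr0 expr0n expr1n add0r.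
have -> : dot_cos (vec3 0 1 (-1)) u ^+ 2 =
    `|dotmx (vec3 0 1 (-1)) u| ^+ 2 / (2 * '[u]).
  by rewrite /dot_cos sqw expr_div_n exprMn !sqrtCK.
have -> : dotmx (vec3 0 1 (-1)) u = (u 0 1 - u 0 2)^*%C.
  rewrite dotmxE mxE !big_ord_recl big_ord0 !mxE /= mul0r add0r mul1r addr0 mulN1r.
  rewrite rmorphB; congr (_ - _); congr (conjc (u _ _)); exact/val_inj.
rewrite normcJ ler_pdivrMr ?mulr_gt0//.
have -> : (4 / 5 : R)%:C%C ^+ 2 * (2 * '[u]) = 32 / 25 * '[u].
  by rewrite rmorphM fmorphV /= !rmorph_nat; field.
set A := `|u 0 1| in u1 *; set B := `|u 0 2|.
have A0 : 0 <= A by exact: normr_ge0.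
have B0 : 0 <= B by exact: normr_ge0.
have Bu : B ^+ 2 <= '[u] := sqnorm3_le u 2.
rewrite (@le_trans _ _ ((A + B) ^+ 2))//.
  by rewrite lerXn2r ?nnegrE ?addr_ge0// ler_normB.
have AB : 0 <= 10 * (10 * A - B) ^+ 2.
  rewrite mulr_ge0// -real_normK ?exprn_ge0//.
  by rewrite rpredB// ?rpredM// ?ger0_real// ler0n.
rewrite -subr_ge0.
rewrite (_ : _ - _ = (11 / 100) * ('[u] - 100 * A ^+ 2) + 11 / 10 * ('[u] - B ^+ 2) +
   7 / 100 * '[u] + 1 / 100 * (10 * (10 * A - B) ^+ 2)); last by field.
have t1 : 0 <= (11 / 100) * ('[u] - 100 * A ^+ 2) by rewrite mulr_ge0 ?divr_ge0 ?subr_ge0.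
have t2 : 0 <= 11 / 10 * ('[u] - B ^+ 2) by rewrite mulr_ge0 ?divr_ge0 ?subr_ge0.
have t3 : 0 <= 7 / 100 * '[u] by rewrite mulr_ge0 ?divr_ge0 ?(ltW u2).
have t4 : 0 <= 1 / 100 * (10 * (10 * A - B) ^+ 2) by rewrite mulr_ge0 ?divr_ge0.
exact: addr_ge0 (addr_ge0 (addr_ge0 t1 t2) t3) t4.
Qed.

(** In every neighborhood there is a point whose orbit ends at [0 : 1 : -1],
    and a point whose orbit approaches the line z1 = 0. *)
Theorem not_fatou_ratio v (x : R) : v != 0 -> -1 <= x <= 1 ->
  v 0 0 ^+ 2 = v 0 1 ^+ 2 + v 0 2 ^+ 2 + 2 * (v 0 1 * v 0 2) * x%:C%C ->
  ~ fatou (@F_map R) setT (mkproj v).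
Proof.
move=> v0 x1 vx /fatouP[_ nE Fv].
have m0 : v 0 1 * v 0 2 != 0.
  apply/eqP => m0; apply: (@not_extended_indeterminacy _ _ _ _ _ _ nE 0%N) => //.
  apply/(indeterminacy_mkproj v0); move: vx; rewrite m0 mulr0 mul0r addr0 => vx.
  apply: vec3_eqP; rewrite !mxE /=.
  - by rewrite vx; ring.
  - rewrite (_ : _ * _ = v 0 1 * (v 0 1 * v 0 2)); last by ring.
    by rewrite m0 mulr0.
  - rewrite vx (_ : _ * _ = v 0 1 * (v 0 1 * v 0 2)); last by ring.
    by rewrite m0 mulr0.
have [z1 z2] : v 0 1 != 0 /\ v 0 2 != 0.
  by move: m0; rewrite mulf_eq0 negb_or => /andP.
have eps0 : 0 < acos (4 / 5 : R) / 2 by rewrite divr_gt0// acos_45_gt0.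
have [d1 d10 d1P] := Fv _ eps0.
have [d2 d20 d2P] : exists2 d : R, 0 < d & forall q, mdist (mkproj v) q < d -> ~ E q.
  have [|d d0 dP] := @closure_metric_not _ _
    (\bigcup_(m in [set m | (1 <= m)%N]) indeterminacy_upto (@F_map R) setT m) (mkproj v).
    by move=> cl; apply: nE; split.
  by exists d => // q /dP nq [_].
pose d := Num.min d1 d2; have d0 : 0 < d by rewrite lt_min d10 d20.
have [tau tau0 tauP] := nearby_ratio v0 d0 vx.
(* a dyadic root of unity, at which [l P_n = 1] for large [n] *)
have [z [M [zn zM z21 zx]]] := dyadic_root x1 tau0.
have z0 : z != 0 by rewrite -normr_eq0 zn oner_eq0.
have [a [a0 va aE]] : exists a, [/\ vec3 a (v 0 1) (v 0 2) != 0,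
      mdist (mkproj v) (mkproj (vec3 a (v 0 1) (v 0 2))) < d &
      a ^+ 2 = v 0 1 ^+ 2 + v 0 2 ^+ 2 + 2 * (v 0 1 * v 0 2) * (complex.Re z)%:C%C].
  apply: tauP; rewrite -rmorphB normc_def /= expr0n addr0 sqrtr_sqr lecR//.
have [b [b0 vb bE]] := disk_approx x1 tau0.
have [c [c0 vc cE]] := tauP _ bE.
have [dd1 dd2] : (d <= d1) /\ (d <= d2) by split; rewrite ge_min lexx ?orbT.
have lva : level (vec3 a (v 0 1) (v 0 2)) (v 0 1 * v 0 2 / z) z.
  by have := @level_unit _ (vec3 a (v 0 1) (v 0 2)) z zn; rewrite !vec3E; apply.
have lvc : level (vec3 c (v 0 1) (v 0 2)) (v 0 1 * v 0 2 / b) b.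
  split; rewrite !vec3E ?divfK// cE; congr (_ + _).
  by field.
have nEa := d2P _ (lt_le_trans va dd2).
have nEc := d2P _ (lt_le_trans vc dd2).
have [cb cb0 cbP] := Phi_lower_bound c0 lvc vb nEc.
have v12 : 0 < 100 * (`|v 0 1| * `|1 - b ^+ 2|) ^+ 2.
  by rewrite mulr_gt0// exprn_gt0// mulr_gt0// normr_gt0// subr_eq0 eq_sym sqr_neq1.
have [N NP] := expr_small vb (divr_gt0 cb0 v12).
pose n := maxn M N.
have [Pa0 PaE] := iter_F_notE n a0 lva z21 nEa.
have [Pc0 PcE] := iter_F_notE n c0 lvc (sqr_neq1 vb) nEc.
have close1 := d1P n _ Logic.I nEa (lt_le_trans va dd1).
have close2 := d1P n _ Logic.I nEc (lt_le_trans vc dd1).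
rewrite metric_sym in close1.
have := le_lt_trans (metric_triangle _ _ _) (ltrD close1 close2).
rewrite -splitr => {close1 close2}.
rewrite PaE PcE.
have zPn : z * Ppow z n = 1.
  rewrite /Ppow -exprS prednK ?expn_gt0//.
  rewrite (_ : (2 ^ n = 2 ^ M * 2 ^ (n - M))%N); last by rewrite -expnD subnKC// leq_maxl.
  by rewrite exprM zM expr1n.
have -> : mkproj (Phi (vec3 a (v 0 1) (v 0 2)) z (Ppow z n)) = mkproj (vec3 0 1 (-1)).
  have PzE : Ppow z n = z^-1 by rewrite -[LHS]mul1r -(mulVf z0) -mulrA zPn mulr1.
  rewrite /Phi PzE !vec3E -(@mkprojZ _ _ (v 0 1 * z^-1 * (1 - z ^+ 2)) (vec3 0 1 (-1))); last first.
    by rewrite !mulf_neq0 ?invr_eq0// subr_eq0 eq_sym.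
  by congr mkproj; rewrite vec3Z !vec3E; congr vec3; field.
apply/negP; rewrite -leNgt; apply: far_from_contracted => //.
apply: le_trans (cbP n); rewrite /Phi vec3E !vec3E !normrM !exprMn.
have Nle : `|Ppow b n| ^+ 2 <= cb / (100 * (`|v 0 1| * `|1 - b ^+ 2|) ^+ 2).
  rewrite -normrX /Ppow -exprM; apply: NP.
  rewrite (leq_trans (leq_maxr M N))//.
  rewrite muln2 -addnn (@leq_trans (2 ^ n).-1)// ?leq_addr//.
  by rewrite -ltnS prednK ?expn_gt0// ltn_expl.
move: Nle; rewrite ler_pdivlMr// => /(le_trans _); apply.
by rewrite exprMn le_eqVlt; apply/orP; left; apply/eqP; ring.
Qed.

End Nonequicontinuity.

(** * Square-integrable functions on the boundary *)
Section Energy.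
Context (R : realType).
Local Notation C := R[i].
Local Notation mu := (bernoulli R).
Local Notation fn := (boundary -> R[i]).
Implicit Types (f g h : fn) (c : C).

Definition nrm (z : C) : R := complex.Re `|z|.

Lemma nrmE z : (nrm z)%:C%C = `|z|.
Proof. by rewrite /nrm normc_def. Qed.

Lemma nrm_ge0 z : 0 <= nrm z.
Proof. by rewrite -ler0c nrmE. Qed.

Lemma nrmM z w : nrm (z * w) = nrm z * nrm w.
Proof. by apply: complexI; rewrite rmorphM /= !nrmE normrM. Qed.

Lemma nrmD z w : nrm (z + w) <= nrm z + nrm w.
Proof. by rewrite -lecR rmorphD /= !nrmE ler_normD. Qed.

Lemma nrm0 : nrm 0 = 0. Proof. by rewrite /nrm normr0. Qed.

Lemma nrmX z n : nrm (z ^+ n) = nrm z ^+ n.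
Proof. by apply: complexI; rewrite rmorphXn /= !nrmE normrX. Qed.

Lemma nrm_eq0 z : nrm z = 0 -> z = 0.
Proof. by move=> z0; apply/eqP; rewrite -normr_eq0 -nrmE z0. Qed.

Lemma sqr_nrm z : nrm z ^+ 2 = complex.Re z ^+ 2 + complex.Im z ^+ 2.
Proof. by rewrite /nrm normc_def /= sqr_sqrtr// addr_ge0 ?sqr_ge0. Qed.

Lemma Re_le_nrm z : `|complex.Re z| <= nrm z.
Proof. by rewrite -lecR nrmE; exact: normc_ge_Re. Qed.

Lemma Im_le_nrm z : `|complex.Im z| <= nrm z.
Proof.
rewrite -(@ler_pXn2r _ 2) ?nnegrE ?nrm_ge0// sqr_nrm real_normK ?num_real//.
by rewrite lerDr sqr_ge0.
Qed.

Lemma nrm_sum I (s : seq I) (F : I -> C) :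
  nrm (\sum_(i <- s) F i) <= \sum_(i <- s) nrm (F i).
Proof.
elim/big_rec2: _ => [|i y z _ yz]; first by rewrite nrm0.
by rewrite (le_trans (nrmD _ _))// lerD2l.
Qed.

Lemma ReD (z w : C) : complex.Re (z + w) = complex.Re z + complex.Re w.
Proof. by case: z; case: w. Qed.
Lemma ImD (z w : C) : complex.Im (z + w) = complex.Im z + complex.Im w.
Proof. by case: z; case: w. Qed.
Lemma ReM (z w : C) : complex.Re (z * w) = complex.Re z * complex.Re w - complex.Im z * complex.Im w.
Proof. by case: z; case: w. Qed.
Lemma ImM (z w : C) : complex.Im (z * w) = complex.Re z * complex.Im w + complex.Im z * complex.Re w.
Proof. by case: z; case: w. Qed.

Definition cmeasurable f :=
  measurable_fun setT (@complex.Re R \o f) /\ measurable_fun setT (@complex.Im R \o f).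

Lemma cmeasurable_cst c : cmeasurable (fun _ => c).
Proof. by split; exact: measurable_cst. Qed.

Lemma cmeasurableD f g : cmeasurable f -> cmeasurable g -> cmeasurable (fun x => f x + g x).
Proof.
move=> [f1 f2] [g1 g2]; split.
  rewrite [X in measurable_fun _ X](_ : _ = (@complex.Re R \o f) \+ (@complex.Re R \o g)).
    exact: measurable_funD.
  by apply/funext => x /=; rewrite ReD.
rewrite [X in measurable_fun _ X](_ : _ = (@complex.Im R \o f) \+ (@complex.Im R \o g)).
  exact: measurable_funD.
by apply/funext => x /=; rewrite ImD.
Qed.

Lemma cmeasurableM f g : cmeasurable f -> cmeasurable g -> cmeasurable (fun x => f x * g x).
Proof.
move=> [f1 f2] [g1 g2]; split.
  rewrite [X in measurable_fun _ X](_ : _ = ((@complex.Re R \o f) \* (@complex.Re R \o g)) \-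
     ((@complex.Im R \o f) \* (@complex.Im R \o g))).
    by apply: measurable_funB; exact: measurable_funM.
  by apply/funext => x /=; rewrite ReM.
rewrite [X in measurable_fun _ X](_ : _ = ((@complex.Re R \o f) \* (@complex.Im R \o g)) \+
     ((@complex.Im R \o f) \* (@complex.Re R \o g))).
  by apply: measurable_funD; exact: measurable_funM.
by apply/funext => x /=; rewrite ImM.
Qed.

Lemma cmeasurableZ c f : cmeasurable f -> cmeasurable (fun x => c * f x).
Proof. exact/cmeasurableM/cmeasurable_cst. Qed.

Lemma cmeasurable_comp (T : boundary -> boundary) f : measurable_fun setT T ->
  cmeasurable f -> cmeasurable (f \o T).
Proof. by move=> mT [f1 f2]; split; [exact: (measurableT_comp f1)|exact: (measurableT_comp f2)]. Qed.

Lemma measurable_sqnrm f : cmeasurable f -> measurable_fun setT (fun x => nrm (f x) ^+ 2).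
Proof.
move=> [f1 f2]; rewrite [X in measurable_fun _ X](_ : _ =
    (fun x => (@complex.Re R \o f) x ^+ 2 + (@complex.Im R \o f) x ^+ 2)).
  by apply: measurable_funD; exact: measurable_funX.
by apply/funext => x; rewrite sqr_nrm.
Qed.

Lemma measurable_Esqnrm f : cmeasurable f ->
  measurable_fun setT (fun x => (nrm (f x) ^+ 2)%:E).
Proof. by move=> mf; apply/measurable_EFinP; exact: measurable_sqnrm. Qed.

Definition energy f : \bar R := (\int[mu]_x (nrm (f x) ^+ 2)%:E)%E.

Lemma energy_ge0 f : (0 <= energy f)%E.
Proof. by apply: integral_ge0 => x _; rewrite lee_fin sqr_ge0. Qed.

Lemma L2normE f : L2norm f = sqrte (energy f).
Proof.
rewrite /L2norm unlock -poweR12_sqrt ?energy_ge0//; congr poweR.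
apply: eq_integral => x _ /=; rewrite -/(nrm (f x)) powR_mulrn//.
by rewrite ger0_norm// nrm_ge0.
Qed.

Lemma Lfun2P (u : boundary -> R) : u \in Lfun mu 2%:E <->
  measurable_fun setT u /\ (\int[mu]_x (u x ^+ 2)%:E < +oo)%E.
Proof.
have E : ('N[mu]_2%:E [EFin \o u] = (\int[mu]_x (u x ^+ 2)%:E) `^ 2^-1)%E.
  rewrite unlock; congr poweR; apply: eq_integral => x _ /=.
  by rewrite powR_mulrn// real_normK ?num_real.
split=> [|[mu_ ui]].
  rewrite inE => /andP[]; rewrite inE /= => mu_; rewrite inE /= /finite_norm E => /lty_poweRy.
  by move=> h; split => //; apply: h.
by apply/andP; split; rewrite inE //= /finite_norm E poweR_lty.
Qed.

Lemma L2P f : L2 f <-> cmeasurable f /\ (energy f < +oo)%E.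
Proof.
have E : cmeasurable f -> (energy f =
    \int[mu]_x (complex.Re (f x) ^+ 2)%:E + \int[mu]_x (complex.Im (f x) ^+ 2)%:E)%E.
  move=> [f1 f2]; rewrite -ge0_integralD//.
  - by apply: eq_integral => x _; rewrite sqr_nrm EFinD.
  - by move=> x _; rewrite lee_fin sqr_ge0.
  - by apply/measurable_EFinP; exact: (@measurable_funX _ _ _ _ (@complex.Re R \o f)).
  - by move=> x _; rewrite lee_fin sqr_ge0.
  - by apply/measurable_EFinP; exact: (@measurable_funX _ _ _ _ (@complex.Im R \o f)).
split=> [[/Lfun2P[f1 e1] /Lfun2P[f2 e2]]|[mf ef]].
  by split => //; rewrite E// lte_add_pinfty.
move: ef; rewrite E// => ef; have [f1 f2] := mf.
split; apply/Lfun2P; split => //; apply: le_lt_trans ef.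
  by rewrite leeDl// integral_ge0// => x _; rewrite lee_fin sqr_ge0.
by rewrite leeDr// integral_ge0// => x _; rewrite lee_fin sqr_ge0.
Qed.

Lemma L2_energy_fin f : L2 f -> energy f \is a fin_num.
Proof. by move=> /L2P[_ h]; rewrite ge0_fin_numE// energy_ge0. Qed.

Lemma energyZ c f : cmeasurable f -> energy (fun x => c * f x) = ((nrm c ^+ 2)%:E * energy f)%E.
Proof.
move=> mf; rewrite -ge0_integralZl//.
- by apply: eq_integral => x _; rewrite nrmM exprMn EFinM.
- exact: measurable_Esqnrm.
- by move=> x _; rewrite lee_fin sqr_ge0.
- by rewrite lee_fin sqr_ge0.
Qed.

Lemma energyD f g : cmeasurable f -> cmeasurable g ->
  (energy (fun x => f x + g x)%R <= 2%:E * energy f + 2%:E * energy g)%E.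
Proof.
move=> mf mg.
rewrite -!ge0_integralZl// ?lee_fin//; try exact: measurable_Esqnrm; try by move=> x _; rewrite lee_fin sqr_ge0.
have p (h : fn) x : (0 <= 2%:E * (nrm (h x) ^+ 2)%:E)%E.
  by rewrite -EFinM lee_fin mulr_ge0 ?sqr_ge0.
have m (h : fn) : cmeasurable h -> measurable_fun setT (fun x => 2%:E * (nrm (h x) ^+ 2)%:E)%E.
  by move=> mh; apply: emeasurable_funM; [exact: measurable_cst|exact: measurable_Esqnrm].
rewrite -ge0_integralD//; [|exact: m|exact: m].
apply: ge0_le_integral => //.
- by move=> x _; rewrite lee_fin sqr_ge0.
- by apply: measurable_Esqnrm; exact: cmeasurableD.
- by apply: emeasurable_funD; exact: m.
move=> x _; rewrite -!EFinM -EFinD lee_fin.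
have h : nrm (f x + g x) ^+ 2 <= (nrm (f x) + nrm (g x)) ^+ 2.
  by rewrite lerXn2r ?nnegrE ?addr_ge0 ?nrm_ge0// nrmD.
by have := sqr_ge0 (nrm (f x) - nrm (g x)); nra.
Qed.

Lemma energy_ae f g : cmeasurable f -> cmeasurable g ->
  {ae mu, forall x, f x = g x} -> energy f = energy g.
Proof.
move=> mf mg fg; apply: ge0_ae_eq_integral => //.
- exact: measurable_Esqnrm.
- exact: measurable_Esqnrm.
- by move=> x _; rewrite lee_fin sqr_ge0.
- by move=> x _; rewrite lee_fin sqr_ge0.
- by apply: filterS fg => x -> _.
Qed.

Lemma energy_eq0 f : cmeasurable f -> energy f = 0%E -> {ae mu, forall x, f x = 0}.
Proof.
move=> mf ef0; have : (\int[mu]_x `|(nrm (f x) ^+ 2)%:E| = 0)%E.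
  by rewrite -[RHS]ef0; apply: eq_integral => x _; rewrite gee0_abs// lee_fin sqr_ge0.
move=> /(ae_eq_integral_abs mu measurableT (measurable_Esqnrm mf)).
apply: filterS => x /(_ Logic.I) /= [] /eqP.
by rewrite expf_eq0 /= => /eqP/nrm_eq0.
Qed.

Lemma L2D f g : L2 f -> L2 g -> L2 (fun x => f x + g x).
Proof.
move=> /L2P[mf ef] /L2P[mg eg]; apply/L2P; split; first exact: cmeasurableD.
by rewrite (le_lt_trans (energyD mf mg))// lte_add_pinfty// lte_mul_pinfty// lee_fin.
Qed.

Lemma L2Z c f : L2 f -> L2 (fun x => c * f x).
Proof.
move=> /L2P[mf ef]; apply/L2P; split; first exact: cmeasurableZ.
by rewrite energyZ// lte_mul_pinfty// lee_fin sqr_ge0.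
Qed.

(** * Bounded operators up to almost everywhere equality *)

Lemma L2norm_bounded (B : fn -> fn) (K : R) : 0 <= K ->
  (forall f, L2 f -> (energy (B f) <= (K ^+ 2)%:E * energy f)%E) ->
  forall f, L2 f -> (L2norm (B f) <= K%:E * L2norm f)%E.
Proof.
move=> K0 h f Lf; rewrite !L2normE.
have -> : K%:E = sqrte (K ^+ 2)%:E by rewrite /= sqrtr_sqr ger0_norm.
rewrite -sqrteM ?lee_fin ?sqr_ge0// lee_sqrt; first exact: h.
by rewrite mule_ge0 ?energy_ge0// lee_fin sqr_ge0.
Qed.

Lemma energy_bounded (B : fn -> fn) : bounded_L2_operator B ->
  exists2 K : R, 0 <= K & forall f, L2 f -> (energy (B f) <= (K ^+ 2)%:E * energy f)%E.
Proof.
move=> [_ _ [K BK]]; exists `|K| => // f Lf.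
have : (L2norm (B f) <= `|K|%:E * L2norm f)%E.
  rewrite (le_trans (BK f Lf))// lee_wpmul2r ?L2normE ?sqrte_ge0//.
  by rewrite lee_fin ler_norm.
rewrite !L2normE.
have -> : `|K|%:E = sqrte (`|K| ^+ 2)%:E by rewrite /= sqrtr_sqr normr_id.
rewrite -sqrteM ?lee_fin ?sqr_ge0// lee_sqrt//.
by rewrite mule_ge0 ?energy_ge0// lee_fin sqr_ge0.
Qed.

(** Boundedness and linearity make an operator well defined on classes. *)
Lemma bounded_ae (B : fn -> fn) f g : bounded_L2_operator B -> L2 f -> L2 g ->
  {ae mu, forall x, f x = g x} -> {ae mu, forall x, B f x = B g x}.
Proof.
move=> bB Lf Lg fg; have [BL BD _] := bB; have [K K0 BK] := energy_bounded bB.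
have Lh : L2 (fun y => -1 * f y + g y) by apply: L2D => //; exact: L2Z.
have [mh _] := (L2P _).1 Lh; have [mBh _] := (L2P _).1 (BL _ Lh).
have h0 : energy (fun y => -1 * f y + g y) = 0%E.
  rewrite (@energy_ae _ (fun=> 0))//; last first.
  - by apply: filterS fg => x ->; rewrite mulN1r addNr.
  - exact: cmeasurable_cst.
  by rewrite /energy nrm0 expr0n integral0.
have /(energy_eq0 mBh) Bh0 : energy (B (fun y => -1 * f y + g y)) = 0%E.
  apply/eqP; rewrite eq_le energy_ge0 andbT (le_trans (BK _ Lh))// h0 mule0//.
apply: filterS2 (BD (-1) f g Lf Lg) Bh0 => x -> /eqP.
by rewrite mulN1r addrC subr_eq0 => /eqP.
Qed.

Lemma bounded_comp (A B : fn -> fn) : bounded_L2_operator A -> bounded_L2_operator B ->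
  bounded_L2_operator (A \o B).
Proof.
move=> bA bB; have [AL AD _] := bA; have [BL BD _] := bB.
have [K K0 AK] := energy_bounded bA; have [K' K'0 BK] := energy_bounded bB.
split=> [f Lf|c f g Lf Lg|]; first exact/AL/BL.
  have LfBg : L2 (fun y => c * B f y + B g y) by apply: L2D; [exact/L2Z/BL|exact: BL].
  have Lcfg : L2 (fun y => c * f y + g y) by apply: L2D => //; exact: L2Z.
  have := bounded_ae bA (BL _ Lcfg) LfBg (BD c f g Lf Lg).
  by apply: filterS2 (AD c _ _ (BL _ Lf) (BL _ Lg)) => x /= -> ->.
exists (K * K'); apply: L2norm_bounded => [|f Lf]; first exact: mulr_ge0.
rewrite (le_trans (AK _ (BL _ Lf)))// exprMn (EFinM (K ^+ 2)) -[leRHS]muleA.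
by apply: lee_wpmul2l; rewrite ?lee_fin ?sqr_ge0//; exact: BK.
Qed.

Lemma bounded_add (A B : fn -> fn) : bounded_L2_operator A -> bounded_L2_operator B ->
  bounded_L2_operator (fun f x => A f x + B f x).
Proof.
move=> bA bB; have [AL AD _] := bA; have [BL BD _] := bB.
have [K K0 AK] := energy_bounded bA; have [K' K'0 BK] := energy_bounded bB.
split=> [f Lf|c f g Lf Lg|]; first by apply: L2D; [exact: AL|exact: BL].
  by apply: filterS2 (AD c f g Lf Lg) (BD c f g Lf Lg) => x -> ->; ring.
exists (2 * (K + K')); apply: L2norm_bounded => [|f Lf]; first by rewrite mulr_ge0// addr_ge0.
have [mA _] := (L2P _).1 (AL _ Lf); have [mB _] := (L2P _).1 (BL _ Lf).
rewrite (le_trans (energyD mA mB))//.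
rewrite (@le_trans _ _ (2%:E * ((K ^+ 2)%:E * energy f) + 2%:E * ((K' ^+ 2)%:E * energy f))%E)//.
  by apply: leeD; apply: lee_wpmul2l; rewrite ?lee_fin//; [exact: AK|exact: BK].
rewrite !muleA -ge0_muleDl ?mule_ge0 ?lee_fin ?sqr_ge0//.
rewrite lee_wpmul2r ?energy_ge0// -!EFinM -EFinD lee_fin.
by have := mulr_ge0 K0 K'0; have := sqr_ge0 K; have := sqr_ge0 K'; nra.
Qed.

Lemma bounded_id : bounded_L2_operator (@id fn).
Proof.
split=> [//|c f g _ _|]; first exact: aeW.
by exists 1 => f _; rewrite mul1e.
Qed.

Lemma bounded_scale c : bounded_L2_operator (fun f x => c * f x).
Proof.
split=> [f|d f g _ _|]; first exact: L2Z.
  by apply: aeW => x; ring.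
exists (nrm c); apply: L2norm_bounded => [|f /L2P[mf _]]; first exact: nrm_ge0.
by rewrite energyZ.
Qed.

Lemma invertible_comp (A B : fn -> fn) : bounded_L2_operator A ->
  bounded_L2_operator B -> L2_invertible A -> L2_invertible B -> L2_invertible (A \o B).
Proof.
move=> bA bB [A' bA' AA'] [B' bB' BB'].
have [AL _ _] := bA; have [BL _ _] := bB; have [AL' _ _] := bA'; have [BL' _ _] := bB'.
exists (B' \o A'); first exact: bounded_comp.
move=> f Lf /=; split.
  have [h1 _] := BB' _ (AL' _ Lf); have [h2 _] := AA' _ Lf.
  have := bounded_ae bA (BL _ (BL' _ (AL' _ Lf))) (AL' _ Lf) h1.
  by apply: filterS2 h2 => x <- ->.
have [_ h1] := AA' _ (BL _ Lf); have [_ h2] := BB' _ Lf.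
have := bounded_ae bB' (AL' _ (AL _ (BL _ Lf))) (BL _ Lf) h1.
by apply: filterS2 h2 => x <- ->.
Qed.

(** The left inverse [Q A'] and the right inverse [A' Q] coincide almost
    everywhere. *)
Lemma invertible_factor (A A' P : fn -> fn) : bounded_L2_operator A ->
  bounded_L2_operator A' -> (forall f, A (A' f) = P f) -> (forall f, A' (A f) = P f) ->
  L2_invertible P -> L2_invertible A.
Proof.
move=> bA bA' AP PA [Q bQ QP].
have [AL _ _] := bA; have [AL' _ _] := bA'; have [QL _ _] := bQ.
have r f : L2 f -> {ae mu, forall x, A (A' (Q f)) x = f x}.
  by move=> Lf; rewrite AP; exact: (QP f Lf).1.
have l f : L2 f -> {ae mu, forall x, Q (A' (A f)) x = f x}.
  by move=> Lf; rewrite PA; exact: (QP f Lf).2.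
have lr f : L2 f -> {ae mu, forall x, A' (Q f) x = Q (A' f) x}.
  move=> Lf; have Lg : L2 (A' (Q f)) by exact/AL'/QL.
  have h1 := l _ Lg.
  have h2 := bounded_ae (bounded_comp bQ bA') (AL _ Lg) Lf (r _ Lf).
  by apply: filterS2 h1 h2 => x /= <- <-.
exists (A' \o Q); first exact: bounded_comp.
move=> f Lf; split; first exact: r.
by apply: filterS2 (lr _ (AL _ Lf)) (l _ Lf) => x /= -> ->.
Qed.

End Energy.

(** * Measure-preserving tree automorphisms *)
Section MeasurePreserving.
Context (R : realType).
Local Notation C := R[i].
Local Notation mu := (bernoulli R).
Local Notation fn := (boundary -> R[i]).
Implicit Types (f g h : fn) (c : C) (T : boundary -> boundary).

Definition preserving T :=
  measurable_fun setT T /\ forall A, measurable A -> mu (T @^-1` A) = mu A.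

Section Transfer.
Context (T : boundary -> boundary) (mT : measurable_fun setT T).
Let T_mixin := isMeasurableFun.Build _ _ _ _ _ mT.
Let T_pack : {mfun boundary >-> boundary} := HB.pack T T_mixin.

Lemma energy_pushforward f : (forall A, measurable A -> mu (T @^-1` A) = mu A) ->
  cmeasurable f -> energy (f \o T) = energy f.
Proof.
move=> pT mf; rewrite /energy.
rewrite [RHS](@eq_measure_integral _ _ _ setT (pushforward mu T_pack)); last first.
  by move=> A mA _; exact/esym/pT.
rewrite [RHS]ge0_integral_pushforward//.
- exact: measurable_Esqnrm.
- by move=> x _; rewrite lee_fin sqr_ge0.
Qed.

(** The cylinders and the empty set are stable under intersection, so that they
    determine the measure. *)
Lemma cylinder_preserving :
  (forall w, exists2 w', size w' = size w & T @^-1` cylinder w = cylinder w') ->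
  forall A, measurable A -> mu (T @^-1` A) = mu A.
Proof.
move=> cT A mA.
pose G : set (set boundary) := [set A | A = set0 \/ range cylinder A].
have mcyl w : measurable (cylinder w : set boundary).
  by apply: sub_sigma_algebra; exists w.
have Gm : G `<=` measurable.
  by move=> _ [->|[w _ <-]]; [exact: measurable0|exact: mcyl].
pose m2' := [the {measure set boundary -> \bar R} of pushforward mu T_pack].
pose m2 := m2' mT.
suff h : forall B, <<s G >> B -> mu B = m2 B.
  apply/esym; apply: (h A).
  by move: A mA; apply: sub_sigma_algebra2 => _ [w _ <-]; right; exists w.
apply: (@g_sigma_algebra_measure_unique _ R boundary G Gm (fun=> setT)).
- move=> _; right; exists [::] => //; exact/seteqP.
- by apply/seteqP; split => // x _; exists 0%N.
- have sub (w w' : seq bool) : (size w <= size w')%N -> G (cylinder w `&` cylinder w').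
    move=> ww'; have [e|ne] := eqVneq w (take (size w) w').
      right; exists w' => //; apply/seteqP; split=> [x xw'|x [] //].
      split => // i iw; rewrite xw' ?(leq_trans iw)//.
      by rewrite [in RHS]e nth_take.
    left; apply/seteqP; split => // x [xw xw'].
    case/eqP: ne; apply: (@eq_from_nth _ false).
      by rewrite size_takel.
    by move=> i iw; rewrite nth_take// -xw// xw'// (leq_trans iw).
  move=> _ _ [->|[w _ <-]] [->|[w' _ <-]].
  + by left; rewrite setI0.
  + by left; rewrite set0I.
  + by left; rewrite setI0.
  + by have [/sub//|/ltnW/sub] := leqP (size w) (size w'); rewrite setIC.
- move=> _ [->|[w _ <-]]; first by rewrite !measure0.
  have [w' sw Tw] := cT w.
  change (mu (cylinder w) = mu (T @^-1` cylinder w)).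
  by rewrite Tw !bernoulliE sw.
- by move=> _; rewrite ltey_eq fin_num_measure.
Qed.

End Transfer.

Lemma cylinder_measurable_fun T :
  (forall w, exists w', T @^-1` cylinder w = cylinder w') -> measurable_fun setT T.
Proof.
move=> cT; apply: (@measurability _ _ boundary boundary setT T (range cylinder)) => //.
move=> _ [_ [w _ <-] <-]; rewrite setTI; have [w' ->] := cT w.
by apply: sub_sigma_algebra; exists w'.
Qed.

Lemma preserving_cylinder T :
  (forall w, exists2 w', size w' = size w & T @^-1` cylinder w = cylinder w') ->
  preserving T.
Proof.
move=> cT; have mT : measurable_fun setT T.
  by apply: cylinder_measurable_fun => w; have [w' _ ->] := cT w; exists w'.
by split => //; exact: cylinder_preserving.
Qed.

Lemma preserving_comp T T' : preserving T -> preserving T' -> preserving (T \o T').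
Proof.
move=> [mT pT] [mT' pT']; split; first exact: measurableT_comp.
move=> A mA; rewrite comp_preimage pT' ?pT//.
by rewrite -[X in measurable X]setTI; exact: mT.
Qed.

Lemma preserving_iter T n : preserving T -> preserving (iter n T).
Proof.
move=> pT; elim: n => [|n IH]; first by split=> [|A mA]; [exact: measurable_id|].
exact: (preserving_comp pT IH).
Qed.

Lemma preserving_ae T (P : boundary -> Prop) : preserving T ->
  {ae mu, forall x, P x} -> {ae mu, forall x, P (T x)}.
Proof.
move=> [mT pT] [N [mN N0 PN]]; exists (T @^-1` N); split.
- by rewrite -[X in measurable X]setTI; exact: mT.
- by rewrite -N0; exact: pT.
- by move=> x /= nP; exact: PN.
Qed.

Lemma energy_comp T f : preserving T -> cmeasurable f -> energy (f \o T) = energy f.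
Proof. by move=> [mT pT]; exact: energy_pushforward. Qed.

Lemma bounded_composition T : preserving T -> bounded_L2_operator (fun f : fn => f \o T).
Proof.
move=> pT; split=> [f /L2P[mf ef]|c f g _ _|].
- apply/L2P; split; last by rewrite energy_comp.
  exact: (cmeasurable_comp pT.1).
- exact: aeW.
- exists 1; apply: L2norm_bounded => // f /L2P[mf _].
  by rewrite energy_comp// expr1n mul1e.
Qed.

Definition btail (x : boundary) : boundary := fun k => x k.+1.

Lemma scons_eta (x : boundary) : x = scons (x 0%N) (btail x).
Proof. by apply/funext => -[]. Qed.

Lemma cylinder_cons b w (x : boundary) :
  cylinder (b :: w) x <-> x 0%N = b /\ cylinder w (btail x).
Proof.
split=> [h|[h1 h2] [|i] //= iw]; last exact: h2.
by split=> [|i iw]; [exact: (h 0%N)|exact: (h i.+1)].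
Qed.

Definition flip_head (w : seq bool) := if w is b :: w' then ~~ b :: w' else [::].

Lemma preimage_gen_a w : gen_a @^-1` cylinder w = cylinder (flip_head w).
Proof.
case: w => [|b w]; first by apply/seteqP; split => x.
apply/seteqP; split=> x /cylinder_cons[h1 h2]; apply/cylinder_cons; split => //.
  by rewrite -h1 /= negbK.
by rewrite /= h1 negbK.
Qed.

Fixpoint gen_t_word (w : seq bool) :=
  if w is b :: w' then b :: (if b then gen_t_word w' else flip_head w') else [::].

Lemma btail_gen_t (x : boundary) :
  btail (gen_t x) = if x 0%N then gen_t (btail x) else gen_a (btail x).
Proof.
rewrite {1}(scons_eta x); case: (x 0%N).
  by rewrite gen_t1.
by rewrite gen_t0.
Qed.

Lemma preimage_gen_t w : gen_t @^-1` cylinder w = cylinder (gen_t_word w).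
Proof.
suff h x : cylinder w (gen_t x) <-> cylinder (gen_t_word w) x.
  by apply/seteqP; split => x /h.
elim: w x => [|b w IH] x; first by split => _ i.
have E : cylinder w (if b then gen_t (btail x) else gen_a (btail x)) <->
    cylinder (if b then gen_t_word w else flip_head w) (btail x).
  case: b; first exact: IH.
  by rewrite -preimage_gen_a.
split=> /cylinder_cons[h1 h2]; apply/cylinder_cons; split => //.
- have x0 : x 0%N = b by exact: h1.
  by apply/E; move: h2; rewrite btail_gen_t x0.
- by rewrite btail_gen_t h1; exact/E.
Qed.

Lemma size_flip_head w : size (flip_head w) = size w. Proof. by case: w. Qed.

Lemma size_gen_t_word w : size (gen_t_word w) = size w.
Proof. by elim: w => //= -[] w IH; rewrite ?IH ?size_flip_head. Qed.

Lemma preserving_gen_a : preserving gen_a.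
Proof.
apply: preserving_cylinder => w; exists (flip_head w); first exact: size_flip_head.
exact: preimage_gen_a.
Qed.

Lemma preserving_gen_t : preserving gen_t.
Proof.
apply: preserving_cylinder => w; exists (gen_t_word w); first exact: size_gen_t_word.
exact: preimage_gen_t.
Qed.

Lemma A_piE (z : 'rV[C]_3) f x :
  A_pi z f x = z 0 0 * f x + z 0 1 * f (gen_a x) + z 0 2 * f (gen_t x).
Proof. by []. Qed.

Lemma bounded_A_pi (z : 'rV[C]_3) : bounded_L2_operator (A_pi z).
Proof.
have b c T : preserving T -> bounded_L2_operator (fun (f : fn) x => c * f (T x)).
  move=> pT; exact: (bounded_comp (bounded_scale c) (bounded_composition pT)).
apply: (bounded_add (bounded_add (bounded_scale _) (b _ _ preserving_gen_a))).
exact: (b _ _ preserving_gen_t).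
Qed.

Lemma measurable_btail : measurable_fun setT btail.
Proof.
apply: (@measurability _ _ boundary boundary setT btail (range cylinder)) => //.
move=> _ [_ [w _ <-] <-]; rewrite setTI.
rewrite [X in measurable X](_ : _ = cylinder (true :: w) `|` cylinder (false :: w)).
  by apply: measurableU; apply: sub_sigma_algebra; [exists (true :: w)|exists (false :: w)].
apply/seteqP; split => [x xw|x [|] /cylinder_cons[_]//].
by case E: (x 0%N); [left|right]; apply/cylinder_cons.
Qed.

Lemma measurable_head : measurable_fun setT (fun x : boundary => x 0%N).
Proof.
apply: (measurable_fun_bool true); rewrite setTI.
rewrite [X in measurable X](_ : _ = cylinder [:: true]).
  by apply: sub_sigma_algebra; exists [:: true].
apply/seteqP; split => [x xw|x /cylinder_cons[]//].
by apply/cylinder_cons; split => // i.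
Qed.

(** Eigenfunctions of the odometer [a t], by the self-similarity of the action:
    the restriction to the subtree [0] of an eigenfunction for [l] is an
    eigenfunction for [l ^- 2]. *)
Lemma odometer_eigenfunction n (l : C) : l ^+ (2 ^ n) = 1 ->
  exists e : fn, [/\ cmeasurable e, forall x, nrm (e x) = 1 &
    forall x, e (gen_a (gen_t x)) = l * e x].
Proof.
elim: n l => [|n IH] l l1.
  exists (fun=> 1); split; first exact: cmeasurable_cst.
    by move=> _; rewrite /nrm normr1.
  by move: l1; rewrite expn0 expr1 => -> _; rewrite mul1r.
have l0 : l != 0.
  apply: contraTneq (oner_neq0 C) => l0.
  by rewrite -l1 l0 expr0n expn_eq0 /= negbK.
have nl : nrm l = 1.
  apply/eqP; rewrite -(@pexpr_eq1 _ _ (2 ^ n.+1)) ?expn_gt0 ?nrm_ge0//.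
  by rewrite -nrmX l1 /nrm normr1.
have [|e0 [me0 ne0 ee0]] := IH (l ^- 2).
  by rewrite exprVn -exprM -expnS l1 invr1.
pose e (x : boundary) := if x 0%N then l * e0 (gen_a (btail x)) else e0 (btail x).
have m1 : cmeasurable (fun x => l * e0 (gen_a (btail x))).
  apply: cmeasurableZ; apply: (@cmeasurable_comp _ (gen_a \o btail) e0) => //.
  exact: (measurableT_comp preserving_gen_a.1 measurable_btail).
have m0 : cmeasurable (e0 \o btail) by exact: (cmeasurable_comp measurable_btail).
exists e; split.
- split.
    rewrite [X in measurable_fun _ X](_ : _ = fun x : boundary => if x 0%N
      then complex.Re (l * e0 (gen_a (btail x))) else complex.Re (e0 (btail x))).
      by apply: measurable_fun_ifT; [exact: measurable_head|exact: m1.1|exact: m0.1].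
    by apply/funext => x /=; rewrite /e; case: (x 0%N).
  rewrite [X in measurable_fun _ X](_ : _ = fun x : boundary => if x 0%N
    then complex.Im (l * e0 (gen_a (btail x))) else complex.Im (e0 (btail x))).
    by apply: measurable_fun_ifT; [exact: measurable_head|exact: m1.2|exact: m0.2].
  by apply/funext => x /=; rewrite /e; case: (x 0%N).
- by move=> x; rewrite /e; case: (x 0%N) => //; rewrite nrmM ne0 nl mulr1.
move=> x; rewrite (scons_eta x); case: (x 0%N); set w := btail x.
  rewrite gen_t1 gen_a1 /e /= -[btail _]/(gen_t w) -[btail _]/w.
  have := ee0 (gen_t w); rewrite gen_tK => ->.
  by rewrite mulrA mulrA -expr2 mulfV ?mul1r// expf_neq0.
rewrite gen_t0 gen_a0 /e /= -[btail _]/(gen_a w) -[btail _]/w.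
by rewrite gen_aK.
Qed.

End MeasurePreserving.

(** * Neumann series along a measure-preserving map *)
Section ComplexLimits.
Context (R : realType).
Local Notation C := R[i].
Implicit Types (u : nat -> C) (z c : C).

(** Convergence in the complex plane, stated on the parts because limits,
    measurability and completeness are used for real sequences. *)
Definition ccvg u z :=
  (fun n => complex.Re (u n)) @ \oo --> complex.Re z /\
  (fun n => complex.Im (u n)) @ \oo --> complex.Im z.

Lemma complexP (z w : C) : complex.Re z = complex.Re w -> complex.Im z = complex.Im w -> z = w.
Proof. by case: z w => a b [c d] /= -> ->. Qed.

Lemma ccvg_unique u z w : ccvg u z -> ccvg u w -> z = w.
Proof.
move=> [z1 z2] [w1 w2]; apply: complexP.
  exact: (cvg_unique _ z1 w1).
exact: (cvg_unique _ z2 w2).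
Qed.

Lemma ccvg_cst c : ccvg (fun=> c) c.
Proof. by split; exact: cvg_cst. Qed.

Lemma ccvgD u v z w : ccvg u z -> ccvg v w -> ccvg (fun n => u n + v n) (z + w).
Proof.
move=> [z1 z2] [w1 w2]; split.
  rewrite ReD (_ : (fun n => _) = (fun n => complex.Re (u n)) \+ (fun n => complex.Re (v n))).
    exact: cvgD.
  by apply/funext => n; rewrite ReD.
rewrite ImD (_ : (fun n => _) = (fun n => complex.Im (u n)) \+ (fun n => complex.Im (v n))).
  exact: cvgD.
by apply/funext => n; rewrite ImD.
Qed.

Lemma ccvgZ c u z : ccvg u z -> ccvg (fun n => c * u n) (c * z).
Proof.
move=> [z1 z2]; split.
  rewrite ReM (_ : (fun n => _) = (fun n => complex.Re c * complex.Re (u n)) \-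
     (fun n => complex.Im c * complex.Im (u n))).
    by apply: cvgB; apply: cvgM => //; exact: cvg_cst.
  by apply/funext => n; rewrite ReM.
rewrite ImM (_ : (fun n => _) = (fun n => complex.Re c * complex.Im (u n)) \+
   (fun n => complex.Im c * complex.Re (u n))).
  by apply: cvgD; apply: cvgM => //; exact: cvg_cst.
by apply/funext => n; rewrite ImM.
Qed.

Lemma ccvgS u z : ccvg u z -> ccvg (fun n => u n.+1) z.
Proof.
move=> [z1 z2]; split.
  by move: z1; rewrite -(cvg_shiftS (fun n => complex.Re (u n))).
by move: z2; rewrite -(cvg_shiftS (fun n => complex.Im (u n))).
Qed.

Lemma ccvg_sqnrm_le u z (M : R) : ccvg u z -> (forall n, nrm (u n) ^+ 2 <= M) ->
  nrm z ^+ 2 <= M.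
Proof.
move=> [z1 z2] uM; rewrite sqr_nrm.
have : (fun n => complex.Re (u n) ^+ 2 + complex.Im (u n) ^+ 2) @ \oo -->
    complex.Re z ^+ 2 + complex.Im z ^+ 2.
  by apply: cvgD; rewrite expr2; under eq_fun do rewrite expr2; exact: cvgM.
by move=> /cvgr_to_le; apply; apply: nearW => n; rewrite -sqr_nrm.
Qed.

Lemma weighted_cauchy_schwarz n (w b : nat -> R) : (forall k, 0 <= w k) ->
  (\sum_(0 <= k < n) w k * b k) ^+ 2 <=
  (\sum_(0 <= k < n) w k) * \sum_(0 <= k < n) w k * b k ^+ 2.
Proof.
move=> w0; set W := \sum_(0 <= k < n) w k; set A := \sum_(0 <= k < n) w k * b k.
set Q := \sum_(0 <= k < n) w k * b k ^+ 2.
have key (t : R) : 0 <= Q - 2 * t * A + t ^+ 2 * W.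
  have -> : Q - 2 * t * A + t ^+ 2 * W = \sum_(0 <= k < n) w k * (b k - t) ^+ 2.
    rewrite /Q /A /W !mulr_sumr -sumrB -big_split /=.
    by apply: eq_bigr => k _; ring.
  by apply: sumr_ge0 => k _; rewrite mulr_ge0// sqr_ge0.
have W0 : 0 <= W by apply: sumr_ge0.
have [W00|Wn0] := eqVneq W 0.
  rewrite W00 mul0r; suff -> : A = 0 by rewrite expr0n.
  rewrite /A big_nat big1// => k /andP[_ kn].
  suff -> : w k = 0 by rewrite mul0r.
  move: W00; rewrite /W big_mkord => /eqP.
  by rewrite psumr_eq0// => /allP/(_ (Ordinal kn)); rewrite mem_index_enum => /(_ isT)/eqP.
have Wp : 0 < W by rewrite lt_def Wn0.
have := key (A / W); rewrite (_ : _ + _ = Q - A ^+ 2 / W); last by field.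
by rewrite subr_ge0 ler_pdivrMr// mulrC.
Qed.

End ComplexLimits.

Section Neumann.
Context (R : realType).
Local Notation C := R[i].
Local Notation mu := (bernoulli R).
Local Notation fn := (boundary -> R[i]).
Context (T : boundary -> boundary) (pT : preserving R T) (l : C).
Hypothesis l1 : `|l| < 1.
Implicit Types (f g h : fn).

Let rho := nrm l.
Let rho0 : 0 <= rho. Proof. exact: nrm_ge0. Qed.
Let rho1 : rho < 1. Proof. by rewrite -ltcR nrmE. Qed.

(** Any weight strictly between |l| and 1 would do; it is nonzero even if
    l = 0, which makes the domination pass from a point to its image. *)
Let s := (1 + rho) / 2.
Let s0 : 0 < s. Proof. by rewrite /s; have := rho0; lra. Qed.
Let s1 : s < 1. Proof. by rewrite /s; have := rho1; lra. Qed.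
Let rs : rho <= s. Proof. by rewrite /s; have := rho1; lra. Qed.

Let W := (1 - s)^-1.
Let W0 : 0 < W. Proof. by rewrite invr_gt0 subr_gt0. Qed.

Let geo_le n : \sum_(0 <= k < n) s ^+ k <= W.
Proof.
have s1' : 0 < 1 - s by rewrite subr_gt0.
rewrite -(ler_pM2l s1') /W mulfV ?gt_eqF// -opprB mulNr big_mkord -subrX1 opprB.
by rewrite lerBlDr lerDl exprn_ge0// ltW.
Qed.

(* [weight] dominates [term] twice: its sum controls the square of the partial
   sums by Cauchy-Schwarz, and its integral is a geometric series because T
   preserves the measure. *)
Let term f k (x : boundary) : C := l ^+ k * f (iter k T x).
Let part f n x := \sum_(0 <= k < n) term f k x.
Let weight f k (x : boundary) : R := s ^+ k * nrm (f (iter k T x)) ^+ 2.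
Let dom f x : \bar R := (\sum_(0 <= k <oo) (weight f k x)%:E)%E.

Let weight_ge0 f k x : 0 <= weight f k x.
Proof. by rewrite mulr_ge0 ?sqr_ge0// exprn_ge0// ltW. Qed.

Let cmeasurable_iter f k : cmeasurable f -> cmeasurable (f \o iter k T).
Proof. by move=> mf; apply: cmeasurable_comp => //; exact: (preserving_iter k pT).1. Qed.

Let measurable_weight f k : cmeasurable f -> measurable_fun setT (weight f k).
Proof.
move=> mf; apply: measurable_funM; first exact: measurable_cst.
exact: (measurable_sqnrm (cmeasurable_iter k mf)).
Qed.

Let measurable_dom f : cmeasurable f -> measurable_fun setT (dom f).
Proof.
move=> mf; apply: (ge0_emeasurable_sum (P := xpredT)).
  by move=> k x _ _; rewrite lee_fin.
by move=> k _; apply/measurable_EFinP; exact: measurable_weight.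
Qed.

Let dom_ge0 f x : (0 <= dom f x)%E.
Proof. by apply: nneseries_ge0 => k _ _; rewrite lee_fin. Qed.

Let int_dom f : cmeasurable f -> (\int[mu]_x dom f x <= W%:E * energy f)%E.
Proof.
move=> mf; rewrite integral_nneseries//; last 2 first.
- by move=> k; apply/measurable_EFinP; exact: measurable_weight.
- by move=> k x _; rewrite lee_fin.
have wE k : (\int[mu]_x (weight f k x)%:E = (s ^+ k)%:E * energy f)%E.
  rewrite -(energy_comp (preserving_iter k pT) mf) -ge0_integralZl//.
  - exact: (measurable_Esqnrm (cmeasurable_iter k mf)).
  - by move=> x _; rewrite lee_fin sqr_ge0.
  - by rewrite lee_fin exprn_ge0// ltW.
apply: lime_le.
  apply: is_cvg_nneseries => k _ _; apply: integral_ge0 => x _.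
  by rewrite lee_fin.
apply: nearW => n; under eq_bigr do rewrite wE.
rewrite -ge0_sume_distrl => [|k _]; last by rewrite lee_fin exprn_ge0// ltW.
by rewrite lee_wpmul2r ?energy_ge0// sumEFin lee_fin.
Qed.

Let good f x := (dom f x < +oo)%E.

Let ae_good f : L2 f -> {ae mu, forall x, good f x}.
Proof.
move=> /L2P[mf ef]; have : mu.-integrable setT (dom f).
  apply/integrableP; split; first exact: measurable_dom.
  under eq_integral do rewrite gee0_abs//.
  by rewrite (le_lt_trans (int_dom mf))// lte_mul_pinfty// lee_fin ltW.
move=> /(integrable_ae measurableT); apply: filterS => x /(_ Logic.I).
by rewrite /good ge0_fin_numE.
Qed.

Let good_weights f x : good f x ->
  exists2 M : R, dom f x = M%:E & forall n, \sum_(0 <= k < n) weight f k x <= M.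
Proof.
move=> gx; have fx : dom f x \is a fin_num by rewrite ge0_fin_numE.
exists (fine (dom f x)) => [|n]; first by rewrite fineK.
rewrite -lee_fin fineK// -sumEFin; apply: nneseries_lim_ge => k _ _.
by rewrite lee_fin.
Qed.

Let good_image f x : good f x -> good f (T x).
Proof.
move=> /good_weights[M _ xM]; rewrite /good (@le_lt_trans _ _ (M / s)%:E) ?ltry//.
apply: lime_le; first by apply: is_cvg_nneseries => k _ _; rewrite lee_fin.
apply: nearW => n; rewrite sumEFin lee_fin ler_pdivlMr//.
apply: le_trans (xM n.+1); rewrite big_nat_recl// mulr_suml.
rewrite ler_wpDl//; apply: ler_sum => k _.
by rewrite /weight -iterSr (exprS s k) le_eqVlt; apply/orP; left; apply/eqP; ring.
Qed.

Let term_le f k x : nrm (term f k x) <= s ^+ k * nrm (f (iter k T x)).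
Proof.
rewrite nrmM nrmX ler_wpM2r ?nrm_ge0// lerXn2r ?nnegrE// ltW//.
Qed.

Let good_part_le f x M : (forall n, \sum_(0 <= k < n) weight f k x <= M) ->
  forall n, nrm (part f n x) ^+ 2 <= W * M.
Proof.
move=> xM n.
have s0k k : 0 <= s ^+ k by rewrite exprn_ge0// ltW.
have := weighted_cauchy_schwarz n (w := fun k => s ^+ k) (fun k => nrm (f (iter k T x))) s0k.
move=> cs; apply: (@le_trans _ _ ((\sum_(0 <= k < n) s ^+ k * nrm (f (iter k T x))) ^+ 2)).
  rewrite lerXn2r ?nnegrE ?nrm_ge0//.
    by apply: sumr_ge0 => k _; rewrite mulr_ge0// nrm_ge0.
  by rewrite (le_trans (nrm_sum _ _))//; apply: ler_sum => k _; exact: term_le.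
apply: le_trans cs _; apply: ler_pM => //.
- by apply: sumr_ge0.
- by apply: sumr_ge0 => k _; exact: weight_ge0.
Qed.

Let good_cvg (v : nat -> R) f x : good f x ->
  (forall k, `|v k| <= nrm (term f k x)) -> cvgn (series v).
Proof.
move=> /good_weights[M _ xM] vt; apply: normed_cvg.
apply: (@series_le_cvg _ _ (fun k => s ^+ k + weight f k x)) => [k|k|k|].
- exact: normr_ge0.
- by rewrite addr_ge0// exprn_ge0// ltW.
- rewrite (le_trans (vt k))// (le_trans (term_le _ _ _))//.
  rewrite /weight -[X in X + _]mulr1 -mulrDr ler_wpM2l ?exprn_ge0 ?ltW//.
  by have := sqr_ge0 (nrm (f (iter k T x)) - 1); have := nrm_ge0 (f (iter k T x)); nra.
apply: nondecreasing_is_cvgn.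
  apply/nondecreasing_seqP => n; rewrite seriesEnat /= big_nat_recr//= lerDl.
  by rewrite addr_ge0// exprn_ge0// ltW.
exists (W + M) => _ [n _ <-]; rewrite seriesEnat /= big_split /=.
by rewrite lerD.
Qed.

Let sum (f : fn) (x : boundary) : C :=
  if (dom f x < +oo)%E then
    Complex (limn (fun n => complex.Re (part f n x)))
            (limn (fun n => complex.Im (part f n x)))
  else 0.

Let Re_part f n x : complex.Re (part f n x) = series (fun k => complex.Re (term f k x)) n.
Proof. by rewrite seriesEnat /part (big_morph (@complex.Re R) (id1 := 0) (@ReD R)). Qed.

Let Im_part f n x : complex.Im (part f n x) = series (fun k => complex.Im (term f k x)) n.
Proof. by rewrite seriesEnat /part (big_morph (@complex.Im R) (id1 := 0) (@ImD R)). Qed.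

Let sum_cvg f x : good f x -> ccvg (fun n => part f n x) (sum f x).
Proof.
move=> gx; rewrite /sum -/(good f x) gx; split => /=.
  rewrite (_ : (fun n => _) = series (fun k => complex.Re (term f k x))).
    by apply: (good_cvg gx) => k; exact: Re_le_nrm.
  by apply/funext => n; exact: Re_part.
rewrite (_ : (fun n => _) = series (fun k => complex.Im (term f k x))).
  by apply: (good_cvg gx) => k; exact: Im_le_nrm.
by apply/funext => n; exact: Im_part.
Qed.

Let cmeasurable_part f n : cmeasurable f -> cmeasurable (part f n).
Proof.
move=> mf; elim: n => [|n IH].
  rewrite (_ : part f 0 = fun=> 0); first exact: cmeasurable_cst.
  by apply/funext => x; rewrite /part big_geq.
rewrite (_ : part f n.+1 = fun x => part f n x + l ^+ n * (f \o iter n T) x).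
  by apply: cmeasurableD => //; apply: cmeasurableZ; exact: cmeasurable_iter.
by apply/funext => x; rewrite /part big_nat_recr.
Qed.

Let measurable_limit f (p : C -> R) : cmeasurable f ->
  (forall n, measurable_fun setT (fun x => p (part f n x))) -> p 0 = 0 ->
  (forall x, good f x -> (fun n => p (part f n x)) @ \oo --> p (sum f x)) ->
  measurable_fun setT (fun x => p (sum f x)).
Proof.
move=> mf mp p0 pc; apply/measurable_EFinP.
apply: (emeasurable_fun_cvg (fun n x => (if (dom f x < +oo)%E then p (part f n x) else 0)%:E)).
  move=> n; apply/measurable_EFinP; apply: measurable_fun_ifT => //.
  apply: measurable_fun_lte; first exact: measurable_dom.
  exact: measurable_cst.
move=> x _; have [gx|gx] := boolP (dom f x < +oo)%E.
  by apply: cvg_EFin; [exact: nearW|exact: pc].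
by rewrite /sum /= (negbTE gx) p0; exact: cvg_cst.
Qed.

Let cmeasurable_sum f : cmeasurable f -> cmeasurable (sum f).
Proof.
move=> mf; split; apply: measurable_limit => //.
- by move=> n; exact: (cmeasurable_part n mf).1.
- by move=> x /sum_cvg[].
- by move=> n; exact: (cmeasurable_part n mf).2.
- by move=> x /sum_cvg[].
Qed.

Let energy_sum f : cmeasurable f -> (energy (sum f) <= (W ^+ 2)%:E * energy f)%E.
Proof.
move=> mf; apply: (@le_trans _ _ (W%:E * \int[mu]_x dom f x)%E); last first.
  by rewrite expr2 EFinM -muleA lee_wpmul2l ?int_dom// lee_fin ltW.
rewrite -ge0_integralZl//; [|exact: measurable_dom|by rewrite lee_fin ltW].
apply: ge0_le_integral => //.
- by move=> x _; rewrite lee_fin sqr_ge0.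
- by apply: measurable_Esqnrm; exact: cmeasurable_sum.
- by apply: emeasurable_funM; [exact: measurable_cst|exact: measurable_dom].
move=> x _; have [gx|gx] := boolP (dom f x < +oo)%E.
  have [M xM Mle] := good_weights gx; rewrite xM -EFinM lee_fin.
  exact: (ccvg_sqnrm_le (sum_cvg gx) (good_part_le Mle)).
by rewrite /sum (negbTE gx) nrm0 expr0n mule_ge0// lee_fin ltW.
Qed.

Let bounded_sum : bounded_L2_operator sum.
Proof.
split=> [f /L2P[mf ef]|c f g Lf Lg|].
- apply/L2P; split; first exact: cmeasurable_sum.
  by rewrite (le_lt_trans (energy_sum mf))// lte_mul_pinfty// lee_fin sqr_ge0.
- have Lh : L2 (fun y => c * f y + g y) by apply: L2D => //; exact: L2Z.
  apply: filterS3 (ae_good Lf) (ae_good Lg) (ae_good Lh) => x gf gg gh.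
  apply: (ccvg_unique (sum_cvg gh)).
  have := ccvgD (ccvgZ c (sum_cvg gf)) (sum_cvg gg).
  rewrite (_ : (fun n => _) = (fun n => part (fun y => c * f y + g y) n x))//.
  apply/funext => n; rewrite /part mulr_sumr -big_split /=.
  by apply: eq_bigr => k _; rewrite /term; ring.
- exists W; apply: L2norm_bounded => [|f /L2P[mf _]]; first exact: ltW.
  exact: energy_sum.
Qed.

(** The inverse is [sum_k l^k f o T^k], which converges almost everywhere. *)
Lemma neumann_invertible : L2_invertible (fun (f : fn) x => f x - l * f (T x)).
Proof.
exists sum => // f Lf; split.
  apply: filterS (ae_good Lf) => x gx; apply/eqP; rewrite subr_eq; apply/eqP.
  apply: (ccvg_unique (ccvgS (sum_cvg gx))).
  have := ccvgD (ccvg_cst (f x)) (ccvgZ l (sum_cvg (good_image gx))).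
  rewrite (_ : (fun n => _) = (fun n => part f n.+1 x))//.
  apply/funext => n; rewrite /part big_nat_recl// /term /= mul1r; congr (_ + _).
  rewrite mulr_sumr; apply: eq_bigr => k _.
  by rewrite exprS mulrA -iterSr.
pose g x := f x - l * f (T x).
have Lg : L2 g.
  have -> : g = (fun x => f x + (- l) * (f \o T) x).
    by apply/funext => x; rewrite /g mulNr.
  apply: L2D => //; apply: L2Z; have [h _ _] := bounded_composition pT.
  exact: h.
apply: filterS2 (ae_good Lf) (ae_good Lg) => x gf gg.
apply: (ccvg_unique (sum_cvg gg)).
(* the n-th partial sum for g telescopes to f - l^n f o T^n *)
have := ccvgD (ccvg_cst (f x)) (ccvgZ (-1) (ccvgD (ccvgS (sum_cvg gf)) (ccvgZ (-1) (sum_cvg gf)))).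
rewrite (_ : f x + -1 * (sum f x + -1 * sum f x) = f x); last by ring.
rewrite (_ : (fun n => _) = (fun n => part g n x))//.
apply/funext => n; rewrite {1}/part big_nat_recr//= -/(part f n x).
rewrite (_ : _ + _ = f x - term f n x); last by ring.
elim: n => [|n IH]; first by rewrite /part big_geq// /term expr0 mul1r subrr.
rewrite /part big_nat_recr//= -/(part g n x) -IH /term /g exprSr iterS.
by ring.
Qed.

End Neumann.

(** * The projective spectrum *)
Section Spectrum.
Context (R : realType).
Local Notation C := R[i].
Local Notation mu := (bernoulli R).
Local Notation fn := (boundary -> R[i]).
Implicit Types (z : 'rV[C]_3) (f g : fn).

Lemma scale_invertible (k : C) : k != 0 -> L2_invertible (fun (f : fn) x => k * f x).
Proof.
move=> k0; exists (fun f x => k^-1 * f x); first exact: bounded_scale.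
by move=> f _; split; apply: aeW => x; rewrite ?mulVKf// mulKf.
Qed.

(** With A' obtained from A by changing the signs of z1 and z2, the product
    A A' = A' A is [k (1 - l u) (1 - l u^-1)] for the unitary [u = a t]. *)
Theorem A_pi_invertible z k l : level z k l -> k != 0 -> `|l| < 1 ->
  L2_invertible (A_pi z).
Proof.
move=> [zq zm] k0 l1; pose z' := vec3 (z 0 0) (- z 0 1) (- z 0 2).
pose N T (f : fn) x := f x - l * f (T x).
pose P := (fun (f : fn) x => k * f x) \o (N (gen_a \o gen_t) \o N (gen_t \o gen_a)).
have pat := preserving_comp (preserving_gen_a R) (preserving_gen_t R).
have pta := preserving_comp (preserving_gen_t R) (preserving_gen_a R).
have bN T : preserving R T -> bounded_L2_operator (N T).
  move=> pT.
  have := bounded_add (@bounded_id R) (bounded_comp (bounded_scale (- l)) (bounded_composition pT)).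
  rewrite (_ : (fun f x => _) = N T)//.
  by apply/funext => f; apply/funext => x; rewrite /N /= mulNr.
have PE f x : P f x = z 0 0 ^+ 2 * f x - (z 0 1 ^+ 2 + z 0 2 ^+ 2) * f x -
    z 0 1 * z 0 2 * (f (gen_a (gen_t x)) + f (gen_t (gen_a x))).
  rewrite /P /N /= gen_aK gen_tK zq zm; ring.
apply: (@invertible_factor _ _ (A_pi z') P); try exact: bounded_A_pi.
- move=> f; apply/funext => x; rewrite PE !A_piE !vec3E gen_aK gen_tK; ring.
- move=> f; apply/funext => x; rewrite PE !A_piE !vec3E gen_aK gen_tK; ring.
have bNN := bounded_comp (bN _ pat) (bN _ pta).
apply: invertible_comp => //; first exact: bounded_scale.
- exact: scale_invertible.
- apply: invertible_comp; try exact: bN.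
  + exact: neumann_invertible.
  + exact: neumann_invertible.
Qed.

Lemma energy_unimodular f : (forall x, nrm (f x) = 1) -> energy f = 1%E.
Proof.
move=> f1; rewrite /energy; under eq_integral do rewrite f1 expr1n.
rewrite integral_cst// mul1e; exact: (@probability_setT _ _ _ (bernoulli R)).
Qed.

(** At a dyadic root of unity the span of an eigenfunction [e] of [a t] and of
    its image under [a] is invariant, and A has a kernel there. *)
Lemma dyadic_kernel z (l : C) n : l ^+ (2 ^ n) = 1 -> l ^+ 2 != 1 ->
  z 0 0 ^+ 2 = (z 0 1 + z 0 2 * l) * (z 0 1 + z 0 2 / l) ->
  exists g, [/\ L2 g, (0 < energy g)%E & forall x, A_pi z g x = 0].
Proof.
move=> ln l21 zq; have l0 : l != 0.
  apply: contraTneq (oner_neq0 C) => l0.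
  by rewrite -ln l0 expr0n expn_eq0 /= negbK.
have [e [me ne ee]] := odometer_eigenfunction ln.
pose e' : fn := e \o gen_a.
have ee' x : e (gen_t x) = l^-1 * e' x.
  by have := ee (gen_t x); rewrite gen_tK /e' /= => ->; rewrite mulKf.
have [al [be [ab0 ab1 ab2]]] : exists al be : C, [/\ ~ (al = 0 /\ be = 0),
    z 0 0 * al + (z 0 1 + z 0 2 * l) * be = 0 &
    z 0 0 * be + (z 0 1 + z 0 2 / l) * al = 0].
  have [p0|p0] := eqVneq (z 0 1 + z 0 2 * l) 0; last first.
    exists (z 0 1 + z 0 2 * l), (- z 0 0); split; first by case=> /eqP; rewrite (negbTE p0).
      by ring.
    by rewrite mulrN -expr2 zq; ring.
  exists 0, 1; split; first by case=> _ /eqP; rewrite oner_eq0.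
    by rewrite p0; ring.
  move: zq; rewrite p0 mul0r => /eqP; rewrite expf_eq0 /= => /eqP ->; ring.
have Le : L2 e by apply/L2P; rewrite energy_unimodular// ltry.
have Le' : L2 e' by have [h _ _] := bounded_composition (preserving_gen_a R); exact: h.
pose g x := al * e x + be * e' x.
have Lg : L2 g by apply: L2D; exact: L2Z.
have [mg _] := (L2P _).1 Lg.
exists g; split => //; last first.
  move=> x; rewrite A_piE /g /e' /= gen_aK ee ee' /e' /=.
  transitivity ((z 0 0 * al + (z 0 1 + z 0 2 * l) * be) * e x +
     (z 0 0 * be + (z 0 1 + z 0 2 / l) * al) * e (gen_a x)); first by field.
  by rewrite ab1 ab2 !mul0r addr0.
rewrite lt_neqAle energy_ge0 andbT eq_sym; apply/eqP => eg0; apply: ab0.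
have g0 := energy_eq0 mg eg0.
have gu0 := preserving_ae (preserving_comp (preserving_gen_a R) (preserving_gen_t R)) g0.
have [x [gx gux]] : exists x, g x = 0 /\ g (gen_a (gen_t x)) = 0.
  apply: contrapT => nx.
  have [N [mN N0 sub]] : {ae mu, forall x : boundary, False}.
    by apply: filterS2 g0 gu0 => x h1 h2; apply: nx; exists x.
  have NT : N = setT by apply/seteqP; split => // x _; apply: sub => /=; case.
  have m1 : mu setT = 1%E := probability_setT (bernoulli R).
  by move: N0; rewrite NT => /(etrans (esym m1))/eqP; rewrite eqe oner_eq0.
have gu : g (gen_a (gen_t x)) = al * (l * e x) + be * (l^-1 * e' x).
  by rewrite /g ee /e' /= gen_aK ee'.
have e0 : e x != 0 by apply/eqP => e0; have := ne x; rewrite e0 nrm0 => /eqP; rewrite eq_sym oner_eq0.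
have e'0 : e' x != 0.
  have h : nrm (e' x) = 1 := ne (gen_a x).
  by apply/eqP => e0'; move: h; rewrite e0' nrm0 => /eqP; rewrite eq_sym oner_eq0.
have ll : l - l^-1 != 0.
  rewrite subr_eq0; apply: contra_neq l21 => ll; rewrite expr2 {2}ll mulfV//.
rewrite gu in gux; rewrite /g in gx.
split; apply/eqP.
  have /eqP : al * (l - l^-1) * e x = 0.
    transitivity ((al * (l * e x) + be * (l^-1 * e' x)) - l^-1 * (al * e x + be * e' x)); first by ring.
    by rewrite gux gx mulr0 subr0.
  by rewrite !mulf_eq0 (negbTE ll) (negbTE e0) !orbF.
have /eqP : be * (l - l^-1) * e' x = 0.
  transitivity (l * (al * e x + be * e' x) - (al * (l * e x) + be * (l^-1 * e' x))); first by ring.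
  by rewrite gux gx mulr0 subr0.
by rewrite !mulf_eq0 (negbTE ll) (negbTE e'0) !orbF.
Qed.

(** Dyadic kernel elements at nearby points are approximate kernel elements. *)
Theorem A_pi_not_invertible z (x : R) : -1 <= x <= 1 ->
  z 0 0 ^+ 2 = z 0 1 ^+ 2 + z 0 2 ^+ 2 + 2 * (z 0 1 * z 0 2) * x%:C%C ->
  ~ L2_invertible (A_pi z).
Proof.
move=> x1 zx [B bB AB].
have [K K0 BK] := energy_bounded bB.
pose M := nrm (2 * (z 0 1 * z 0 2)).
have M0 : 0 <= M by exact: nrm_ge0.
have D0 : 0 < (K ^+ 2 + 1) * (M + 1) by rewrite mulr_gt0// ltr_wpDl// sqr_ge0.
have tau0 : 0 < ((K ^+ 2 + 1) * (M + 1))^-1 by rewrite invr_gt0.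
have [l [n [ln lpow l21 lx]]] := dyadic_root x1 tau0.
have [a aE az] := nearby_sqrt (z 0 0)
  (z 0 1 ^+ 2 + z 0 2 ^+ 2 + 2 * (z 0 1 * z 0 2) * (complex.Re l)%:C%C).
have l0 : l != 0 by rewrite -normr_eq0 ln oner_eq0.
have [|g [Lg eg Ag]] := @dyadic_kernel (vec3 a (z 0 1) (z 0 2)) l n lpow l21.
  rewrite !vec3E aE -mulrA [_ * _%:C%C]mulrC mulrA -(norm1_addV ln); field.
  exact: l0.
have [mg _] := (L2P _).1 Lg.
pose d := z 0 0 - a.
have AgE : A_pi z g = fun y => d * g y.
  apply/funext => y; have := Ag y; rewrite !A_piE !vec3E => h.
  by rewrite -[RHS]addr0 -h /d; ring.
have d2 : nrm d ^+ 2 * K ^+ 2 < 1.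
  have h : nrm d ^+ 2 <= M * ((K ^+ 2 + 1) * (M + 1))^-1.
    have : nrm d ^+ 2 <= M * `|x - complex.Re l|.
      rewrite -lecR rmorphXn rmorphM /= !nrmE (le_trans az)// zx.
      rewrite (_ : _ - _ = 2 * (z 0 1 * z 0 2) * (x%:C%C - (complex.Re l)%:C%C)); last by ring.
      rewrite normrM ler_wpM2l// -rmorphB normc_def /= expr0n addr0 sqrtr_sqr.
      by [].
    by move=> /le_trans; apply; rewrite ler_wpM2l// distrC.
  have K20 : 0 <= K ^+ 2 by exact: sqr_ge0.
  apply: (le_lt_trans (ler_wpM2r K20 h)).
  rewrite mulrAC ltr_pdivrMr// mul1r; nra.
have LA : L2 (A_pi z g) by rewrite AgE; exact: L2Z.
have [BL _ _] := bB; have [mBA _] := (L2P _).1 (BL _ LA).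
have : (energy g <= (K ^+ 2)%:E * ((nrm d ^+ 2)%:E * energy g))%E.
  have := BK _ LA; rewrite (energy_ae mBA mg (AB g Lg).2).
  by rewrite AgE energyZ.
rewrite muleA -EFinM mulrC -(fineK (L2_energy_fin Lg)) -EFinM lee_fin.
have e0 : 0 < fine (energy g) by rewrite -lte_fin fineK// L2_energy_fin.
by rewrite leNgt gtr_pMl// d2.
Qed.

End Spectrum.

(** * The Julia set of G on M *)
Section Embedding.
Context (R : realType).
Local Notation C := R[i].
Local Notation "''[' u ]" := (dotmx u u) : ring_scope.
Implicit Types (u v w : 'rV[C]_3).

(** The linear map behind [X]; it intertwines the polynomial maps F and G. *)
Definition embed w : 'rV[C]_5 :=
  let h := w 0 2 / 2 in row_of_seq 5 [:: w 0 0 - h; w 0 1; h; h; h].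

Lemma embedB u v : embed (u - v) = embed u - embed v.
Proof. by apply/rowP => -[[|[|[|[|[|//]]]]] hj]; rewrite !mxE /=; ring. Qed.

Lemma embedZ c u : embed (c *: u) = c *: embed u.
Proof. by apply/rowP => -[[|[|[|[|[|//]]]]] hj]; rewrite !mxE /=; ring. Qed.

Lemma G_embed u : G_map (embed u) = embed (F_map u).
Proof. by apply/rowP => -[[|[|[|[|[|//]]]]] hj]; rewrite !mxE /=; field. Qed.

Lemma sqnorm_embed u : '[embed u] =
  `|u 0 0 - u 0 2 / 2| ^+ 2 + `|u 0 1| ^+ 2 + 3 * `|u 0 2 / 2| ^+ 2.
Proof. by rewrite dotmx_sum !big_ord_recl big_ord0 !mxE /=; ring. Qed.

Lemma sqnormD_le (a b : C) : `|a + b| ^+ 2 <= 2 * `|a| ^+ 2 + 2 * `|b| ^+ 2.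
Proof.
rewrite (@le_trans _ _ ((`|a| + `|b|) ^+ 2))//.
  by rewrite lerXn2r ?nnegrE ?addr_ge0// ler_normD.
rewrite -subr_ge0 (_ : _ - _ = (`|a| - `|b|) ^+ 2); last by ring.
by rewrite real_exprn_even_ge0// rpredB// ger0_real.
Qed.

Lemma sqnorm_embed_le u : '[embed u] <= 4 * '[u].
Proof.
rewrite sqnorm_embed sqnorm3.
have h2 : `|u 0 2 / 2| ^+ 2 = `|u 0 2| ^+ 2 / 4.
  by rewrite normrM normfV [`|2|]ger0_norm//; field.
have := sqnormD_le (u 0 0) (- (u 0 2 / 2)); rewrite normrN h2 => h.
rewrite (le_trans (lerD (lerD h (lexx _)) (lexx _)))// -subr_ge0.
rewrite (_ : _ - _ = 2 * `|u 0 0| ^+ 2 + 3 * `|u 0 1| ^+ 2 + 11 / 4 * `|u 0 2| ^+ 2); last by field.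
have p i : 0 <= `|u 0 i| ^+ 2 by rewrite exprn_ge0.
by apply: addr_ge0; [apply: addr_ge0|]; apply: mulr_ge0 => //; apply: divr_ge0.
Qed.

Lemma sqnorm_embed_ge u : '[u] <= 4 * '[embed u].
Proof.
rewrite sqnorm_embed sqnorm3.
have h2 : `|u 0 2| ^+ 2 = 4 * `|u 0 2 / 2| ^+ 2.
  by rewrite normrM normfV [`|2|]ger0_norm//; field.
have := sqnormD_le (u 0 0 - u 0 2 / 2) (u 0 2 / 2); rewrite subrK h2 => h.
rewrite (le_trans (lerD (lerD h (lexx _)) (lexx _)))// -subr_ge0.
rewrite (_ : _ - _ = 2 * `|u 0 0 - u 0 2 / 2| ^+ 2 + 3 * `|u 0 1| ^+ 2 +
  6 * `|u 0 2 / 2| ^+ 2); last by ring.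
by apply: addr_ge0; [apply: addr_ge0|]; apply: mulr_ge0 => //; apply: exprn_ge0.
Qed.

Lemma embed_eq0 u : embed u = 0 -> u = 0.
Proof.
move=> e0; apply/eqP; rewrite -(dnorm_eq0 (@dotmx C 3)) /= eq_le dnorm_ge0 andbT.
by have := sqnorm_embed_ge u; rewrite e0 linear0l /= mulr0.
Qed.

Lemma M_set_range : @M_set R = range (@X_map R).
Proof.
apply/seteqP; split=> [p [h23 h34]|_ [p _ <-]].
  pose w := vec3 (coords p 0 0 + coords p 0 4) (coords p 0 1) (2 * coords p 0 4).
  have we : embed w = coords p.
    apply/rowP => -[[|[|[|[|[|//]]]]] hj]; rewrite mxE /= !vec3E.
    - by rewrite mulrAC mulfV ?pnatr_eq0// mul1r addrK; congr (coords p _ _); exact/val_inj.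
    - by congr (coords p _ _); exact/val_inj.
    - rewrite mulrAC mulfV ?pnatr_eq0// mul1r -h34 -h23.
      by congr (coords p _ _); exact/val_inj.
    - rewrite mulrAC mulfV ?pnatr_eq0// mul1r -h34.
      by congr (coords p _ _); exact/val_inj.
    - by rewrite mulrAC mulfV ?pnatr_eq0// mul1r; congr (coords p _ _); exact/val_inj.
  have w0 : w != 0.
    apply/eqP => w0; have := coords_neq0 p; rewrite -we w0 -(scale0r (0 : 'rV[C]_3)) embedZ scale0r.
    by rewrite eqxx.
  exists (mkproj w) => //; rewrite -[RHS]coordsK -we.
  have [c c0 cE] := coords_mkproj w0.
  by rewrite -[X_map _]/(mkproj (embed (coords (mkproj w)))) cE embedZ mkprojZ.
have e0 : embed (coords p) != 0.
  by apply: contra_neq (coords_neq0 p); exact: embed_eq0.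
rewrite /M_set /= -[X_map p]/(mkproj (embed (coords p))).
by have [c c0 ->] := coords_mkproj e0; rewrite !mxE.
Qed.

End Embedding.

(** Both sides are read off the invariant ratio: in [-1, 1] it gives
    non-invertibility and failure of equicontinuity, elsewhere invertibility
    and, off [E_F], equicontinuity. *)
Theorem julia_F (R : realType) : julia (@F_map R) setT =
  @projective_spectrum R `|` extended_indeterminacy (@F_map R) setT.
Proof.
apply/seteqP; split=> p.
  move=> [_ nF]; apply: contrapT => /not_orP[nS nE]; apply: nF.
  have inv : L2_invertible (A_pi (coords p)) by apply: contrapT.
  have [[x x1 vx]|[k [l [k0 l1 vl]]]] := level_dichotomy (coords p).
    by case: (A_pi_not_invertible x1 vx).
  rewrite -(coordsK p); apply: (fatou_level (coords_neq0 p) vl k0 l1).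
  by rewrite coordsK.
move=> [nS|Ep]; split => //; last by case.
have [[x x1 vx]|[k [l [k0 l1 vl]]]] := level_dichotomy (coords p).
  by rewrite -(coordsK p); exact: (not_fatou_ratio (coords_neq0 p) x1 vx).
by case: nS; exact: (A_pi_invertible vl k0 l1).
Qed.

Theorem corollary6p5 (R : realType) :
  julia (@G_map R) (@M_set R) =
  @X_map R @` @projective_spectrum R `|`
  @X_map R @` extended_indeterminacy (@F_map R) setT.
Proof.
rewrite -image_setU -julia_F.
apply: (@transport_julia R 2 4 3 (@F_map R) (@G_map R) (@embed R) 4).
- exact: embedB.
- exact: embedZ.
- by [].
- exact: sqnorm_embed_le.
- exact: sqnorm_embed_ge.
- exact: G_embed.
- exact: G_map_homog.
- exact: M_set_range.
Qed.
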